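(* Let $X$ be a CB process with branching mechanism $\Phi$ given by $(\alpha,\beta,\pi)$, and let $x>0$. Assume that the Lévy measure $\pi$ is unbounded, i.e. has unbounded support. Then for any $t\in(0,\infty)$, as $r\to\infty$, $$\mathbf{P}_x\left[\sup_{s\in(0,t]}\Delta X_s>r\right]\sim\frac{x}{\alpha}(1-e^{-\alpha t})\,\pi(r,\infty),$$ where for $\alpha=0$ the quantity $\frac1\alpha(1-e^{-\alpha t})$ is understood as $t$.
   Context: A branching mechanism is a function $\Phi(\lambda)=\alpha\lambda+\beta\lambda^2+\int_{(0,\infty)}(e^{-\lambda\theta}-1+\lambda\theta)\,\pi(d\theta)$, $\lambda\ge0$, with $\alpha\in\mathbb{R}$, $\beta\ge0$ and $\pi$ a $\sigma$-finite measure on $(0,\infty)$ (the Lévy measure) with $\int_{(0,\infty)}(\theta\wedge\theta^2)\,\pi(d\theta)<\infty$; the case $\Phi\equiv0$ is excluded. A CB process with branching mechanism $\Phi$ is an rcll $[0,\infty)$-valued Markov process $X=(X_t)_{t\ge0}$ such that, writing $\mathbf{P}_x$ for its law when $X_0=x$ and $\mathbf{E}_x$ for the expectation, $\mathbf{E}_x[e^{-\lambda X_t}]=e^{-xv_t(\lambda)}$ for $\lambda\ge0$, where $v_t(\lambda)$ is the unique locally bounded nonnegative solution of $v_t(\lambda)=\lambda-\int_0^t\Phi(v_s(\lambda))\,ds$. $\Delta X_s=X_s-X_{s-}$ for $s>0$. $f(r)\sim g(r)$ means $f(r)/g(r)\to1$. *)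

(* Defs.v *)
From HB Require Import structures.
From mathcomp Require Import all_boot all_order all_algebra.
From mathcomp Require Import all_classical all_reals all_analysis.
From mathcomp Require Import measurable_realfun.

Set Implicit Arguments.
Unset Strict Implicit.
Unset Printing Implicit Defensive.
Import Order.TTheory GRing.Theory Num.Theory.
Import numFieldNormedType.Exports.

Local Open Scope classical_set_scope.
Local Open Scope ring_scope.

Section BranchingMechanism.
Variable R : realType.
Implicit Types (alpha beta : R).
Implicit Types (pi : {sigma_finite_measure set R -> \bar R}).

(* When [branching_parameters] holds, the integrand lies between 0 and
   C * min(theta, theta^2) with C depending on lambda, so the real-valued
   integral is the true one for every lambda >= 0. *)
Definition branching_mechanism alpha beta pi (lambda : R) : R :=
  alpha * lambda + beta * lambda ^+ 2
  + \int[pi]_(theta in `]0, +oo[)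
      (expR (- (lambda * theta)) - 1 + lambda * theta).

(* A measure on (0, oo) is encoded as a measure on the line for which
   (-oo, 0] is a null set. *)
Record branching_parameters alpha beta pi : Prop := BranchingParameters {
  beta_ge0 : 0 <= beta;
  levy_positive_axis : pi `]-oo, 0]%classic = 0%E;
  levy_integrable :
    (\int[pi]_(theta in `]0%R, +oo[) (Num.min theta (theta ^+ 2))%:E < +oo)%E;
  mechanism_neq0 :
    exists2 lambda : R, 0 <= lambda & branching_mechanism alpha beta pi lambda != 0
}.

Definition measure_support (mu : set R -> \bar R) : set R :=
  [set y | forall U : set R, open U -> U y -> (0 < mu U)%E].

Definition unbounded_measure (mu : set R -> \bar R) : Prop :=
  ~ bounded_set (measure_support mu).

(* [v s] is v_s(lambda) for a fixed lambda.  Integrability is required because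
   the real-valued integral also has a value for non-integrable functions. *)
Record cumulant_solution (Phi : R -> R) (lambda : R) (v : R -> R) : Prop :=
  CumulantSolution {
  cumulant_ge0 : forall s : R, 0 <= s -> 0 <= v s;
  cumulant_locally_bounded :
    forall t : R, 0 <= t -> exists M : R, forall s : R, 0 <= s <= t -> v s <= M;
  cumulant_integrable : forall t : R, 0 <= t ->
    lebesgue_measure.-integrable `[0, t] (fun s => (Phi (v s))%:E);
  cumulant_equation : forall t : R, 0 <= t ->
    v t = lambda - \int[lebesgue_measure]_(s in `[0, t]) Phi (v s)
}.

End BranchingMechanism.

Section Paths.
Variable R : realType.

Definition rcll (f : R -> R) : Prop :=
  (forall t : R, 0 <= t -> f s @[s --> t^'+] --> f t) /\
  (forall t : R, 0 < t -> cvg (f s @[s --> t^'-])).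

Definition jump (f : R -> R) (s : R) : R := f s - lim (f u @[u --> s^'-]).

Definition sup_jump (f : R -> R) (t : R) : \bar R :=
  ereal_sup [set (jump f s)%:E | s in `]0, t]].

End Paths.

Section Processes.
Context (R : realType) (d : measure_display) (T : measurableType d).
Implicit Types (X : R -> T -> R) (P : R -> probability T R).

Definition past X (s : R) : set (set T) :=
  <<s [set A | exists (u : R) (B : set R),
        [/\ 0 <= u <= s, measurable B & A = X u @^-1` B]] >>.

(* Time-homogeneous Markov process with state space [0, oo): [P x] is the law
   on [T] when the process [X] starts at [x].  Times and states are reals;
   only nonnegative ones are relevant. *)
Record markov_process X P : Prop := MarkovProcess {
  process_measurable : forall t : R, 0 <= t ->
    measurable_fun setT (X t);
  process_ge0 : forall (t : R) w, 0 <= t -> 0 <= X t w;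
  process_start : forall x : R, 0 <= x -> P x (X 0 @^-1` [set x]) = 1%E;
  transition_measurable : forall (t : R) (B : set R),
    0 <= t -> measurable B ->
    measurable_fun (`[0, +oo[%classic : set R)
      (fun x => P x (X t @^-1` B));
  markov_property : forall (x s t : R) (A : set T) (B : set R),
    0 <= x -> 0 <= s -> 0 <= t -> past X s A -> measurable B ->
    P x (A `&` X (s + t) @^-1` B) =
      (\int[P x]_(w in A) P (X s w) (X t @^-1` B))%E
}.

Record cb_process (Phi : R -> R) X P : Prop := CBProcess {
  cb_markov : markov_process X P;
  cb_rcll : forall w, rcll (fun t => X t w);
  cb_laplace : exists2 v : R -> R -> R,
    forall lambda : R, 0 <= lambda ->
      cumulant_solution Phi lambda (fun t => v t lambda) &
    forall x t lambda : R, 0 <= x -> 0 <= t -> 0 <= lambda ->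
      ('E_(P x)[(fun w => expR (- (lambda * X t w)))]
        = (expR (- (x * v t lambda)))%:E)%E
}.

End Processes.

(* (1 - e^(-alpha t)) / alpha, read as t when alpha = 0. *)
Definition discount (R : realType) (alpha t : R) : R :=
  if alpha == 0 then t else (1 - expR (- (alpha * t))) / alpha.

(* Main.v *)
(* Discretise (0, t] with mesh h.  Since the paths are rcll, the largest jump
   exceeds r exactly when, for some d > 0, all fine enough grids (equivalently,
   arbitrarily fine grids) have an increment exceeding r + d; so it suffices to
   bound the probability that some increment X_(s+h) - X_s exceeds r.

   Put Z = exp (- (X_(s+h) - X_s)).  By the Markov property the conditional
   k-th moment of Z given the past is exp (- X_s (v_h(k) - k)), and
   v_h(k) - k = - h Phi(k) + O(h^2).  Hence, for a polynomial p = sum p_k 'X^k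
   with p(1) = 0, the conditional mean of p(Z) is h X_s sum p_k Phi(k) + O(h^2),
   and for p = (1 - 'X)^2 q this sum is 2 beta q(1) + int p(e^-th) dpi.
   Polynomials q close to the indicator of [0, e^-r] turn this into
   P(X_(s+h) - X_s > r | past) ~ h X_s pi(r, oo), up to factors
   (1 - e^-r)^2 -> 1, uniformly on {X_s <= K}.

   Summing over the grid, with E X_s = x e^(-alpha s), gives the upper bound by
   subadditivity, and the lower bound because the event that an earlier
   increment was large costs at most K times its own probability, which is
   O(pi(r, oo)).  The contribution of {X_s > K} is small uniformly in s, by
   comparison with the explicit means of (1 - e^(-l X_s)) / l. *)
Require Import Defs.
From HB Require Import structures.
From mathcomp Require Import all_boot all_order all_algebra.
From mathcomp Require Import all_classical all_reals all_analysis.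
From mathcomp Require Import measurable_realfun ring lra zify.
Import Order.TTheory GRing.Theory Num.Theory.
Import numFieldNormedType.Exports.
Local Open Scope classical_set_scope.
Local Open Scope ring_scope.

(** The law of X is given only through its Laplace transform, with no generator or jump measure at
    hand, so every estimate of an increment is read off exponential moments, hence off polynomials
    in Z. The factor (1 - 'X)^2 makes this possible: its double root at 1 cancels the drift and the
    compensator, and (1 - e^-th)^2 <= min(th, th^2) is integrable against pi, whose mass near 0 may
    be infinite. As X can decrease, Z may exceed 1; but X_(s+h) >= 0 gives Z <= e^(X_s), so on {X_s
    <= K} the polynomial q must be controlled on [0, e^K], although pi only sees [0, 1]. A
    polynomial is never a sharp indicator, so thresholds carry margins: increments above r + d are
    compared with pi(r, oo) from above, increments above r with pi(r + d, oo) from below, and right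
    continuity of the tail removes the margin. Second moments of X may be infinite, so states above
    K enter only through E[X_s; X_s > K]; the constant multiplying it is fixed before K is
    chosen. *)

Section ElementaryBounds.

(** * Inequalities for the exponential function *)

Context {R : realType}.
Implicit Types u z a b e : R.

Lemma expRN_sub1D_ge0 u : 0 <= expR (- u) - 1 + u.
Proof. have := expR_ge1Dx (- u); lra. Qed.

Lemma expRN_le1 u : 0 <= u -> expR (- u) <= 1.
Proof. by move=> u0; rewrite -expR0 ler_expR; lra. Qed.

Lemma expRN_sub1D_le u : 0 <= u -> expR (- u) - 1 + u <= Num.min u (u ^+ 2).
Proof.
move=> u0; rewrite le_min; apply/andP; split.
  have := expRN_le1 u u0; lra.
have h1 : 0 < expR u := expR_gt0 u.
have h2 := expR_ge1Dx u.
have h3 : expR (- u) * expR u = 1 by rewrite -expRD addNr expR0.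
have h4 : 0 < expR (- u) := expR_gt0 _.
have : expR (- u) * (1 + u) <= 1 by rewrite -[leRHS]h3 ler_pM2l.
rewrite expr2 => h5.
(* The right-hand side is 1 + u^3, hence at least 1. *)
suff : expR (- u) * (1 + u) <= (1 - u + u * u) * (1 + u).
  by rewrite ler_pM2r; lra.
nra.
Qed.

Lemma sqr_1BexpRN_le u : 0 <= u -> (1 - expR (- u)) ^+ 2 <= Num.min u (u ^+ 2).
Proof.
move=> u0; have h1 := expRN_le1 u u0; have h2 := expRN_sub1D_ge0 u.
have h4 : 0 < expR (- u) := expR_gt0 _.
by rewrite le_min; apply/andP; split; nra.
Qed.

Lemma dist_expR1_le u c : `|u| <= c -> `|expR u - 1| <= expR c * `|u|.
Proof.
move=> uc; have h1 := expR_ge1Dx u; have h2 := expR_ge1Dx (- u).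
have h3 : expR (- u) * expR u = 1 by rewrite -expRD addNr expR0.
have h4 : 0 < expR u := expR_gt0 _.
have h5 : expR u <= expR c by rewrite ler_expR; apply: le_trans (ler_norm _) uc.
have h6 : 1 <= expR c by rewrite -expR0 ler_expR; apply: le_trans uc.
have [u0|u0] := leP 0 u.
  rewrite ger0_norm; last lra.
  rewrite ger0_norm//; nra.
have h7 : expR u <= 1 by rewrite -expR0 ler_expR ltW.
rewrite ler0_norm; last lra.
rewrite ltr0_norm//; nra.
Qed.

Lemma dist_expR1D_le u c : `|u| <= c ->
  `|expR u - 1 - u| <= expR c * u ^+ 2.
Proof.
move=> uc; have h1 := expR_ge1Dx u; have h2 := expR_ge1Dx (- u).
have h3 : expR (- u) * expR u = 1 by rewrite -expRD addNr expR0.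
have h4 : 0 < expR u := expR_gt0 _.
have h5 : expR u <= expR c by rewrite ler_expR; apply: le_trans (ler_norm _) uc.
have h6 : 1 <= expR c by rewrite -expR0 ler_expR; apply: le_trans uc.
rewrite ger0_norm; last lra.
have [u0|u0] := leP 0 u.
  have : expR u - 1 <= expR u * u by nra.
  move=> h7; have : expR u * u - u <= expR c * u ^+ 2.
    rewrite expr2; have : (expR u - 1) * u <= (expR u * u) * u by nra.
    nra.
  lra.
have := expRN_sub1D_le (- u); rewrite opprK oppr_ge0 => /(_ (ltW u0)).
rewrite le_min => /andP[_]; rewrite sqrrN => h7.
have h8 := sqr_ge0 u; nra.
Qed.

End ElementaryBounds.

(** * Explicit polynomial approximation of the indicator of an interval *)

Section IndicatorPolynomial.
Context {R : realType}.
Implicit Types z a b e : R.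

Lemma bernoulli_ge (x : R) n : 0 <= x <= 1 -> 1 - n%:R * x <= (1 - x) ^+ n.
Proof.
move=> /andP[x0 x1]; elim: n => [|n IH]; first by rewrite expr0; lra.
rewrite exprS -natr1.
have hn : 0 <= n%:R :> R by [].
have h1 : (1 - x) * (1 - n%:R * x) <= (1 - x) * (1 - x) ^+ n.
  by apply: ler_wpM2l => //; lra.
apply: le_trans h1; nra.
Qed.

(** Induction from (1 - x)(1 + (n+1)x) <= 1 + nx. It forces (1 - x)^n to be small as soon as nx is
    large, where [bernoulli_ge] keeps it near 1 when nx is small. *)
Lemma bernoulli_le (x : R) n : 0 <= x <= 1 -> (1 - x) ^+ n * (1 + n%:R * x) <= 1.
Proof.
move=> /andP[x0 x1]; elim: n => [|n IH]; first by rewrite expr0; lra.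
rewrite exprS -natr1.
have hn : 0 <= n%:R :> R by [].
have hp : 0 <= (1 - x) ^+ n by apply: exprn_ge0; lra.
apply: le_trans IH; rewrite mulrAC mulrC; apply: ler_wpM2l => //; nra.
Qed.

Lemma archi_expr_ge (y c : R) : 1 < y -> exists n, c <= y ^+ n.
Proof.
move=> y1; have [n hn] : exists n : nat, c <= n%:R * (y - 1).
  exists (Num.bound `|c / (y - 1)|); have yp : 0 < y - 1 by lra.
  rewrite -ler_pdivrMr//; apply: le_trans (ler_norm _) _.
  by apply/ltW/archi_boundP.
exists n; apply: le_trans hn _; elim: n => [|n IH]; first by rewrite mul0r.
rewrite exprS -natr1; have hn : 0 <= n%:R :> R by [].
have h1 : 1 <= y ^+ n by apply: exprn_ege1; exact: ltW.
nra.
Qed.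

(* The witness is (1 - (z/M)^n)^N with N about e (M/a)^n: then N (z/M)^n is at
   most e for z <= a, and at least e (b/a)^n - 1 for z >= b. *)
Lemma indicator_poly a b M e : 0 < a < b -> 0 < M -> b <= M -> 0 < e ->
  exists q : {poly R},
    [/\ forall z, 0 <= z <= M -> 0 <= q.[z] <= 1,
        forall z, 0 <= z <= a -> 1 - e <= q.[z] &
        forall z, b <= z <= M -> q.[z] <= e].
Proof.
move=> /andP[a0 ab] M0 bM e0.
have ba1 : 1 < b / a by rewrite ltr_pdivlMr// mul1r.
have [n hn] := archi_expr_ge (b / a) ((1 + e^-1) / e) ba1.
have Mn0 : 0 < (M / a) ^+ n by rewrite exprn_gt0// divr_gt0.
have eM0 : 0 <= e * (M / a) ^+ n by rewrite mulr_ge0// ltW.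
pose N := Num.truncn (e * (M / a) ^+ n).
have [N1 N2] : N%:R <= e * (M / a) ^+ n /\ e * (M / a) ^+ n < N.+1%:R.
  by have /andP[] := truncn_itv eM0.
have haM : (a / M) ^+ n * (M / a) ^+ n = 1.
  by rewrite -exprMn mulrA divfK ?gt_eqF// divff ?gt_eqF// expr1n.
have hbM : (b / M) ^+ n * (M / a) ^+ n = (b / a) ^+ n.
  by rewrite -exprMn mulrA divfK ?gt_eqF.
have hM z : 0 <= z <= M -> 0 <= (z / M) ^+ n <= 1.
  move=> /andP[z0 zM]; apply/andP; split; first by rewrite exprn_ge0// divr_ge0// ltW.
  by rewrite exprn_ile1// ?divr_ge0 ?(ltW M0)// ler_pdivrMr// mul1r.
have hX z w : 0 <= z -> z <= w -> (z / M) ^+ n <= (w / M) ^+ n.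
  move=> z0 zw; apply: lerXn2r; rewrite ?nnegrE ?divr_ge0 ?(ltW M0)//; first lra.
  by rewrite ler_pM2r ?invr_gt0.
exists ((1 - (M^-1 *: 'X) ^+ n) ^+ N).
have qE z : ((1 - (M^-1 *: 'X) ^+ n) ^+ N).[z] = (1 - (z / M) ^+ n) ^+ N.
  by rewrite !hornerE/= [M^-1 * z]mulrC.
split=> z /andP[z1 z2]; rewrite qE.
- have /andP[h1 h2] : 0 <= (z / M) ^+ n <= 1 by apply: hM; lra.
  by rewrite exprn_ge0 ?exprn_ile1//; lra.
- have hz' : 0 <= z <= M by lra.
  have h := hM _ hz'; apply: le_trans (bernoulli_ge _ N h).
  have h1 : (z / M) ^+ n <= (a / M) ^+ n by apply: hX.
  have h2 : N%:R * (z / M) ^+ n <= N%:R * (a / M) ^+ n by exact: ler_wpM2l.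
  have h3 : N%:R * (a / M) ^+ n <= e * (M / a) ^+ n * (a / M) ^+ n.
    by apply: ler_wpM2r => //; rewrite exprn_ge0// divr_ge0// ltW.
  have h4 : e * (M / a) ^+ n * (a / M) ^+ n = e.
    by rewrite -mulrA [X in _ * X]mulrC haM mulr1.
  lra.
- have hz' : 0 <= z <= M by lra.
  have h := hM _ hz'; have h1 := bernoulli_le _ N h.
  have /andP[h0 h0'] := h.
  have h2 : (b / M) ^+ n <= (z / M) ^+ n by apply: hX; lra.
  have h3 : e * (b / a) ^+ n <= N.+1%:R * (b / M) ^+ n.
    rewrite -hbM mulrC -mulrA [leLHS]mulrC mulrC [leRHS]mulrC; apply: ler_wpM2l.
      by rewrite exprn_ge0// divr_ge0 ?(ltW M0)//; lra.
    by rewrite mulrC ltW.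
  have h4 : 1 + e^-1 <= e * (b / a) ^+ n by rewrite -ler_pdivrMl// mulrC.
  have h5 : e^-1 <= N%:R * (z / M) ^+ n.
    have h6 : N.+1%:R * (b / M) ^+ n <= N.+1%:R * (z / M) ^+ n by exact: ler_wpM2l.
    move: h6 h3 h4; rewrite -natr1; lra.
  have hp : 0 <= (1 - (z / M) ^+ n) ^+ N by rewrite exprn_ge0//; lra.
  have : (1 - (z / M) ^+ n) ^+ N * e^-1 <= 1.
    apply: le_trans h1; apply: ler_wpM2l => //; lra.
  by rewrite ler_pdivrMr// mul1r.
Qed.

End IndicatorPolynomial.

(** * Integrals of finite linear combinations *)

Section LinearCombination.
Context {d : measure_display} {T : measurableType d} {R : realType}.
Variables (mu : {measure set T -> \bar R}) (D : set T) (mD : measurable D).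
Variables (c : nat -> R) (f : nat -> T -> R).
Hypothesis intf : forall k, mu.-integrable D (EFin \o f k).

Lemma integrable_scale (a : R) (g : T -> R) : mu.-integrable D (EFin \o g) ->
  mu.-integrable D (EFin \o (fun x => a * g x)).
Proof.
move=> ig; rewrite (_ : _ \o _ = fun x => a%:E * (g x)%:E)%E//.
exact: integrableZl.
Qed.

Lemma integrable_lincomb n :
  mu.-integrable D (EFin \o (fun x => \sum_(k < n) c k * f k x)).
Proof.
elim: n => [|n IH].
  rewrite (_ : _ \o _ = cst 0%E) ?integrable0//.
  by apply/funext => y /=; rewrite big_ord0.
rewrite (_ : _ \o _ = (EFin \o (fun x => \sum_(k < n) c k * f k x)) \+
    (fun x => (c n)%:E * (f n x)%:E)%E).
  by apply: integrableD => //; apply: integrableZl => //; exact: intf.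
by apply/funext => y /=; rewrite big_ord_recr.
Qed.

Lemma Rintegral_lincomb n :
  \int[mu]_(x in D) (\sum_(k < n) c k * f k x) =
  \sum_(k < n) c k * \int[mu]_(x in D) f k x.
Proof.
elim: n => [|n IH].
  rewrite big_ord0 /Rintegral; under eq_integral do rewrite big_ord0.
  by rewrite integral0.
under eq_Rintegral do rewrite big_ord_recr/=.
rewrite RintegralD//; last 2 first.
- exact: integrable_lincomb.
- by apply: integrable_scale; exact: intf.
by rewrite IH big_ord_recr/= RintegralZl//; exact: intf.
Qed.

End LinearCombination.

(** * Coefficient sums as derivatives at 1 *)

Section PolynomialMoments.
Variable R : comNzRingType.
Implicit Types p q : {poly R}.

(** With its companion for the second derivative, this evaluates the linear and quadratic terms of
    Phi at the integers, summed against the coefficients of p. *)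
Lemma deriv_horner1 p : p^`().[1] = \sum_(k < size p) p`_k * k%:R.
Proof.
rewrite -{1}[p]coefK poly_def raddf_sum horner_sum; apply: eq_bigr => k _ /=.
by rewrite derivZ derivXn hornerZ hornerMn hornerXn expr1n.
Qed.

Lemma deriv2_horner1 p :
  p^`()^`().[1] = \sum_(k < size p) p`_k * (k%:R ^+ 2 - k%:R).
Proof.
rewrite -{1}[p]coefK poly_def !raddf_sum horner_sum; apply: eq_bigr => k _ /=.
rewrite !derivZ derivXn derivMn derivXn hornerZ !hornerMn hornerXn expr1n.
case: (val k) => [|n]; first by rewrite mulr0n expr0n subrr.
by congr (_ * _); rewrite -mulrnA natrM -natr1; ring.
Qed.

End PolynomialMoments.

(** * The Lévy measure, its tail, and the regularity of the branching mechanism *)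

Section LevyMeasure.
Context {R : realType} {alpha beta : R}
  { pi : {sigma_finite_measure set R -> \bar R} }.
Hypothesis bp : branching_parameters alpha beta pi.
Notation axis := (`]0, +oo[%classic : set R).
Notation Phi := (branching_mechanism alpha beta pi).
Notation levy_tail r := (fine (pi `]r, +oo[%classic)).

Definition levy_mass : R := \int[pi]_(th in axis) (Num.min th (th ^+ 2)).

Lemma axis_gt0 (th : R) : axis th -> 0 < th.
Proof. by rewrite /= in_itv/= andbT. Qed.

Lemma min_sqr_ge0 (th : R) : 0 <= th -> 0 <= Num.min th (th ^+ 2).
Proof. by move=> t0; rewrite le_min t0 sqr_ge0. Qed.

Lemma measurable_min_sqr (D : set R) : 
  measurable_fun D (fun th : R => Num.min th (th ^+ 2)).
Proof. by apply: measurable_minr => //; apply: exprn_measurable. Qed.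

Lemma integrable_min_sqr :
  pi.-integrable axis (fun th : R => (Num.min th (th ^+ 2))%:E).
Proof.
apply/integrableP; split; first by apply/measurable_EFinP; exact: measurable_min_sqr.
apply: le_lt_trans (levy_integrable bp); rewrite le_eqVlt; apply/orP; left.
apply/eqP; apply: eq_integral => th /set_mem/axis_gt0 th0 /=.
by rewrite ger0_norm// min_sqr_ge0// ltW.
Qed.

Lemma levy_mass_ge0 : 0 <= levy_mass.
Proof. by apply: Rintegral_ge0 => th /axis_gt0 th0; rewrite min_sqr_ge0// ltW. Qed.

Lemma integrable_levy (f : R -> R) (C : R) : measurable_fun axis f ->
  (forall th, 0 < th -> `|f th| <= C * Num.min th (th ^+ 2)) ->
  pi.-integrable axis (EFin \o f).
Proof.
move=> mf fC.
apply: (@le_integrable _ _ _ _ _ _ _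
  (fun th : R => (C * Num.min th (th ^+ 2))%:E)) => //.
- exact/measurable_EFinP.
- move=> th /axis_gt0 th0 /=; rewrite lee_fin; apply: le_trans (fC _ th0) _.
  exact: ler_norm.
- rewrite (_ : (fun _ => _) = (fun th : R => C%:E * (Num.min th (th ^+ 2))%:E)%E)//.
  by apply: integrableZl => //; exact: integrable_min_sqr.
Qed.

Lemma Rintegral_levy_le (f : R -> R) (C : R) : measurable_fun axis f ->
  (forall th, 0 < th -> `|f th| <= C * Num.min th (th ^+ 2)) ->
  \int[pi]_(th in axis) f th <= C * levy_mass.
Proof.
move=> mf fC; rewrite -RintegralZl//; last exact: integrable_min_sqr.
apply: le_Rintegral => //.
- exact: integrable_levy fC.
- apply: (integrable_levy _ `|C|) => [|th th0].
    by apply: measurable_funM => //; exact: measurable_min_sqr.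
  by rewrite normrM (ger0_norm (min_sqr_ge0 _ _))// ltW.
- move=> th /axis_gt0 th0; apply: le_trans (fC _ th0); exact: ler_norm.
Qed.

Lemma levy_tail_fin (r : R) : 0 < r -> (pi `]r, +oo[%classic < +oo)%E.
Proof.
move=> r0; pose c := Num.min r (r ^+ 2).
have c0 : 0 < c by rewrite lt_min r0 exprn_gt0.
suff : (c%:E * pi `]r, +oo[%classic < +oo)%E.
  by move=> h; rewrite -(@lte_pmul2l _ c%:E) ?lte_fin// mulry gtr0_sg// mul1e.
rewrite -integral_cst//=.
apply: le_lt_trans (levy_integrable bp).
apply: (@le_trans _ _ (\int[pi]_(th in `]r, +oo[) (Num.min th (th ^+ 2))%:E))%E.
  apply: ge0_le_integral => //=.
  - by move=> *; rewrite lee_fin ltW.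
  - by apply/measurable_EFinP; exact: measurable_min_sqr.
  - move=> th; rewrite in_itv/= andbT => rth; rewrite lee_fin /c.
    by rewrite le_min !ge_min (ltW rth)/= lerXn2r ?nnegrE ?orbT//; lra.
apply: ge0_subset_integral => //=.
- by apply/measurable_EFinP; exact: measurable_min_sqr.
- by move=> th /axis_gt0 th0; rewrite lee_fin min_sqr_ge0// ltW.
- by apply: subset_itvr; rewrite bnd_simp ltW.
Qed.

Lemma levy_tail_fin_num (r : R) : 0 < r -> pi `]r, +oo[%classic \is a fin_num.
Proof. by move=> r0; rewrite ge0_fin_numE// levy_tail_fin. Qed.

(** If the tail were null, the open half-lines []-oo, 0[] and []r, +oo[] would both be null and the
    support would lie in [0, r]. Positivity is what allows division by the tail in the final
    ratio. *)
Lemma levy_tail_gt0 (r : R) : unbounded_measure pi -> 0 < r -> 0 < levy_tail r.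
Proof.
move=> up r0; rewrite fine_gt0// levy_tail_fin// andbT lt_neqAle measure_ge0 andbT.
apply/eqP => h; apply: up; exists r; split; first by rewrite num_real.
move=> M rM y /= sy; rewrite ler_norml; apply/andP; split.
  rewrite leNgt; apply/negP => yM.
  have := sy (`]-oo, 0[%classic : set R); rewrite ltNge.
  have -> : (pi (`]-oo, 0%R[%classic) <= 0)%E.
    rewrite -(levy_positive_axis bp); apply: le_measure; rewrite ?inE//.
    by apply: subset_itvl; rewrite bnd_simp.
  have o0 : open (`]-oo, 0%R[%classic : set R) by exact: interval_open.
  move=> /(_ o0) h2; suff : ~~ true by [].
  by apply: h2; rewrite /= in_itv/=; lra.
rewrite leNgt; apply/negP => yM.
have := sy `]r, +oo[%classic; rewrite -h ltxx.
have o0 : open (`]r, +oo[%classic : set R) by exact: interval_open.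
move=> /(_ o0) h2; suff : false by [].
by apply: h2; rewrite /= in_itv/= andbT; lra.
Qed.

(** Right continuity of the tail, by continuity of the measure along increasing sets; it brings the
    lower bound back to the exact level r. *)
Lemma levy_tail_shift (r : R) : 0 < r ->
  levy_tail (r + n.+1%:R^-1) @[n --> \oo] --> levy_tail r.
Proof.
move=> r0.
have bigU : \bigcup_n `]r + n.+1%:R^-1, +oo[%classic = `]r, +oo[%classic :> set R.
  apply/seteqP; split => y /=.
    move=> [n _] /=; rewrite !in_itv/= !andbT; apply: le_lt_trans.
    by rewrite lerDl.
  rewrite in_itv/= andbT => ry.
  have yr : 0 < y - r by lra.
  exists (Num.truncn (y - r)^-1) => //=; rewrite in_itv/= andbT.
  rewrite addrC -ltrBrDr -[ltRHS]invrK ltf_pV2 ?posrE ?invr_gt0//.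
  exact: truncnS_gt.
rewrite -bigU; apply: fine_cvg; rewrite fineK; last by rewrite bigU levy_tail_fin_num.
apply: nondecreasing_cvg_mu => //.
- by apply: bigcup_measurable => n _.
- move=> m n mn; apply/subsetPset; apply: subset_itvr; rewrite bnd_simp lerD2l.
  by rewrite lef_pV2 ?posrE// ler_nat.
Qed.

(** Markov's inequality: for r >= 1, min(th, th^2) = th >= r on the tail. *)
Lemma levy_tail_le (r : R) : 1 <= r -> levy_tail r <= levy_mass / r.
Proof.
move=> r1; have r0 : 0 < r by lra.
rewrite ler_pdivlMr// mulrC.
have -> : r * levy_tail r = \int[pi]_(_ in `]r, +oo[) r by rewrite Rintegral_cst.
apply: fine_le.
- by rewrite integral_cst//= fin_numM// levy_tail_fin_num.
- exact: (integrable_fin_num _ integrable_min_sqr).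
apply: (@le_trans _ _ (\int[pi]_(th in `]r, +oo[) (Num.min th (th ^+ 2))%:E))%E.
  apply: ge0_le_integral => //=.
  - by move=> *; rewrite lee_fin ltW.
  - by apply/measurable_EFinP; exact: measurable_min_sqr.
  - move=> th; rewrite in_itv/= andbT => rth; rewrite lee_fin le_min.
    by apply/andP; split; nra.
apply: ge0_subset_integral => //=.
- by apply/measurable_EFinP; exact: measurable_min_sqr.
- by move=> th /axis_gt0 th0; rewrite lee_fin min_sqr_ge0// ltW.
- by apply: subset_itvr; rewrite bnd_simp ltW.
Qed.

Lemma levy_tail_cvg0 : levy_tail r @[r --> +oo] --> (0 : R).
Proof.
apply/cvgrPdist_le => e e0; near=> r.
have r1 : 1 <= r by near: r; exact: nbhs_pinfty_ge.
rewrite sub0r normrN ger0_norm ?fine_ge0//.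
apply: le_trans (levy_tail_le _ r1) _; rewrite ler_pdivrMr; last lra.
rewrite mulrC -ler_pdivrMr//; near: r; exact: nbhs_pinfty_ge.
Unshelve. all: by end_near. Qed.


Definition compensated (l th : R) : R := expR (- (l * th)) - 1 + l * th.

Lemma measurable_expRN (D : set R) l :
  measurable_fun D (fun th : R => expR (- (l * th))).
Proof.
apply: measurableT_comp => //; apply: measurableT_comp => //.
Qed.

Lemma measurable_compensated (D : set R) l : measurable_fun D (compensated l).
Proof.
apply: measurable_funD; last exact: measurable_funM.
by apply: measurable_funB => //; exact: measurable_expRN.
Qed.

Lemma compensated_le (l th : R) : 0 <= l -> 0 < th ->
  0 <= compensated l th <= (l + l ^+ 2) * Num.min th (th ^+ 2).
Proof.
move=> l0 th0; have lth : 0 <= l * th by rewrite mulr_ge0// ltW.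
rewrite /compensated expRN_sub1D_ge0/=; apply: le_trans (expRN_sub1D_le _ lth) _.
rewrite exprMn; have l2 := sqr_ge0 l; have th2 := sqr_ge0 th.
by rewrite ge_min; case: (leP th (th ^+ 2)) => h; apply/orP; [left|right]; nra.
Qed.

Lemma integrable_compensated l : 0 <= l ->
  pi.-integrable axis (EFin \o compensated l).
Proof.
move=> l0; apply: (integrable_levy _ (l + l ^+ 2)).
  exact: measurable_compensated.
by move=> th th0; have /andP[h1 h2] := compensated_le _ _ l0 th0; rewrite ger0_norm.
Qed.

(** Without its linear term the mechanism is nonnegative and o(l) at 0; these two facts bound the
    cumulant by l e^(-alpha t) from above and, up to a factor near 1, from below. *)
Definition nonlinear_part l := beta * l ^+ 2 + \int[pi]_(th in axis) compensated l th.

Lemma mechanismE l : Phi l = alpha * l + nonlinear_part l.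
Proof. by rewrite /branching_mechanism /nonlinear_part addrA. Qed.

Lemma nonlinear_part_ge0 l : 0 <= l -> 0 <= nonlinear_part l.
Proof.
move=> l0; apply: addr_ge0; first by rewrite mulr_ge0 ?sqr_ge0// (beta_ge0 bp).
by apply: Rintegral_ge0 => th /axis_gt0 th0; have /andP[] := compensated_le _ _ l0 th0.
Qed.

(** Divided by l, the integrand is at most min(th, l th^2), which tends to 0 pointwise under the
    integrable bound min(th, th^2). The limit is taken along l = 1/(n+1) only, the bound being
    monotone in l. *)
Lemma compensated_small (e : R) : 0 < e -> exists2 n : nat, (0 < n)%N &
  forall l, 0 <= l <= n%:R^-1 -> \int[pi]_(th in axis) compensated l th <= e * l.
Proof.
move=> e0.
pose f (n : nat) (th : R) := (Num.min th (n.+1%:R^-1 * th ^+ 2))%:E.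
have mf n : measurable_fun axis (f n).
  apply/measurable_EFinP/measurable_minr => //; exact: measurable_funM.
have n1 n : 0 < (n.+1%:R^-1 : R) <= 1 by rewrite invr_gt0 ltr0n/= invf_le1// ler1n.
have f_ge0 n th : axis th -> 0 <= Num.min th (n.+1%:R^-1 * th ^+ 2).
  by move/axis_gt0 => th0; rewrite le_min (ltW th0) mulr_ge0// sqr_ge0.
have fle n th : axis th -> Num.min th (n.+1%:R^-1 * th ^+ 2) <= Num.min th (th ^+ 2).
  move=> th0; rewrite le_min ge_min lexx ge_min/= ler_piMl ?orbT ?sqr_ge0//.
  by have /andP[] := n1 n.
have cf : (\int[pi]_(th in axis) f n th @[n --> \oo] --> \int[pi]_(th in axis) 0)%E.
  have [//|//|//||||_ _] := @dominated_convergence _ _ _ pi axis _ f (cst 0%E)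
     (fun th => (Num.min th (th ^+ 2))%:E); last exact.
  - apply/aeW => th /axis_gt0 th0; apply/fine_cvgP; split; first exact: nearW.
    apply: (@squeeze_cvgr _ _ _ _ (fun=> 0) (fun n : nat => th ^+ 2 * n.+1%:R^-1)).
    + apply: nearW => n /=; rewrite f_ge0/= ?in_itv/= ?andbT//.
      by rewrite ge_min mulrC lexx orbT.
    + exact: cvg_cst.
    + rewrite -[X in _ --> X](mulr0 (th ^+ 2)); apply: cvgM; first exact: cvg_cst.
      exact: cvg_harmonic.
  - exact: integrable_min_sqr.
  - apply/aeW => th n ath; rewrite /f /= lee_fin ger0_norm ?f_ge0//.
    exact: fle.
rewrite integral0 in cf.
have : \forall n \near \oo, `|fine (\int[pi]_(th in axis) f n th)%E| < e.
  have /fine_cvg := cf => /cvgrPdist_lt /(_ _ e0).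
  by apply: filterS => n /=; rewrite sub0r normrN.
move=> [n _ /(_ n (leqnn _))] hn; exists n.+1 => // l /andP[l0 ln].
have If : pi.-integrable axis (EFin \o (fun th => Num.min th (n.+1%:R^-1 * th ^+ 2))).
  apply: (integrable_levy _ 1); first by apply/measurable_EFinP; exact: mf.
  move=> th th0; rewrite mul1r ger0_norm ?fle ?f_ge0//= in_itv/= th0//.
apply: (@le_trans _ _ (\int[pi]_(th in axis) (l * Num.min th (n.+1%:R^-1 * th ^+ 2)))).
  apply: le_Rintegral => //.
  - exact: integrable_compensated.
  - exact: integrable_scale.
  - move=> th /axis_gt0 th0; have lth : 0 <= l * th by rewrite mulr_ge0// ltW.
    apply: le_trans (expRN_sub1D_le _ lth) _.
    rewrite minr_pMr// le_min !ge_min lexx/= exprMn expr2 -mulrA.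
    apply/orP; right; apply: ler_wpM2l => //; apply: ler_wpM2r => //; exact: sqr_ge0.
rewrite RintegralZl// mulrC; apply: ler_wpM2r => //.
by apply: ltW; apply: le_lt_trans hn; exact: ler_norm.
Qed.

Lemma nonlinear_part_small (e : R) : 0 < e ->
  exists2 d, 0 < d & forall l, 0 <= l <= d -> nonlinear_part l <= e * l.
Proof.
move=> e0; have e20 : 0 < e / 2 by lra.
have [n n0 hn] := compensated_small _ e20.
have b0 := beta_ge0 bp.
exists (Num.min n%:R^-1 (e / 2 / (beta + 1))).
  by rewrite lt_min invr_gt0 ltr0n n0 divr_gt0//; lra.
move=> l /andP[l0]; rewrite le_min => /andP[ln].
rewrite ler_pdivlMr; last lra.
have := hn l; rewrite l0 ln => /(_ isT); rewrite /nonlinear_part expr2; nra.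
Qed.

(** The difference is the compensated term of m - l plus (1 - e^(-l th))(1 - e^(-(m-l) th)). Both
    parts are nonnegative and of order (m - l) min(th, th^2), the product because each factor is at
    most 1 and at most its exponent. *)
Lemma compensated_lipschitz (l m th : R) : 0 <= l -> l <= m -> 0 < th ->
  `|compensated m th - compensated l th|
    <= (2 * m + 2) * (m - l) * Num.min th (th ^+ 2).
Proof.
move=> l0 lm th0.
have sth : 0 <= (m - l) * th by nra.
have lth : 0 <= l * th by nra.
have h1 := expRN_sub1D_ge0 ((m - l) * th).
have := expRN_sub1D_le _ sth.
have h3 := expRN_le1 _ sth.
have h4 := expRN_le1 _ lth.
have h5 := expRN_sub1D_ge0 (l * th).
have -> : compensated m th - compensated l th =
   (expR (- ((m - l) * th)) - 1 + (m - l) * th) +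
   (1 - expR (- (l * th))) * (1 - expR (- ((m - l) * th))).
  have : expR (- (m * th)) = expR (- (l * th)) * expR (- ((m - l) * th)).
    by rewrite -expRD; congr expR; ring.
  by rewrite /compensated => ->; ring.
rewrite le_min => /andP[h6 h7].
rewrite ger0_norm; last by apply: addr_ge0 => //; apply: mulr_ge0; lra.
set x := expR (- ((m - l) * th)) in h1 h3 h6 h7 *.
set y := expR (- (l * th)) in h4 h5 *.
have y0 : 0 <= y by exact: expR_ge0.
have x0 : 0 <= x by exact: expR_ge0.
have k1 : (1 - y) * (1 - x) <= 1 - x by nra.
have k2 : (1 - y) * (1 - x) <= (l * th) * ((m - l) * th).
  by apply: ler_pM; lra.
by case: (leP th (th ^+ 2)) => h; nra.
Qed.

(** This regularity suffices to differentiate the cumulant in time and to make its first-order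
    expansion accurate to O(h^2). *)
Lemma mechanism_lipschitz (M : R) : exists2 C, 0 <= C &
  forall l m, 0 <= l <= M -> 0 <= m <= M -> `|Phi m - Phi l| <= C * `|m - l|.
Proof.
have b0 := beta_ge0 bp; have d0 := levy_mass_ge0.
exists (`|alpha| + 2 * beta * `|M| + (2 * `|M| + 2) * levy_mass).
  by rewrite !addr_ge0// !mulr_ge0// addr_ge0// mulr_ge0.
suff H l m : 0 <= l -> l <= m -> m <= M -> `|Phi m - Phi l|
    <= (`|alpha| + 2 * beta * `|M| + (2 * `|M| + 2) * levy_mass) * (m - l).
  move=> l m /andP[l0 lM] /andP[m0 mM]; have [lm|ml] := leP l m.
    by rewrite [X in _ * X]ger0_norm ?subr_ge0// H.
  rewrite distrC [X in _ * X]distrC [X in _ * X]ger0_norm ?subr_ge0 ?(ltW ml)//.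
  by rewrite H// ltW.
move=> l0 lm mM; have m0 : 0 <= m by lra.
have M0 : 0 <= M by lra.
rewrite (ger0_norm M0).
have -> : Phi m - Phi l = alpha * (m - l) + beta * (m + l) * (m - l)
    + \int[pi]_(th in axis) (compensated m th - compensated l th).
  rewrite RintegralB//; [|exact: integrable_compensated..].
  by rewrite !mechanismE /nonlinear_part; ring.
apply: le_trans (ler_normD _ _) _; rewrite mulrDl; apply: lerD.
  apply: le_trans (ler_normD _ _) _; rewrite mulrDl !normrM.
  rewrite (ger0_norm b0) (@ger0_norm _ (m - l)) ?(@ger0_norm _ (m + l)); [|lra..].
  by rewrite lerD2l; apply: ler_wpM2r; [lra|nra].
have Id : pi.-integrable axis (EFin \o (fun th => compensated m th - compensated l th)).
  by apply: (integrableB _ (integrable_compensated _ _) (integrable_compensated _ _)).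
apply: le_trans (le_normr_Rintegral _ Id) _ => //.
rewrite -mulrA [levy_mass * _]mulrC mulrA.
apply: Rintegral_levy_le.
  apply: measurableT_comp => //.
  by apply: measurable_funB; exact: measurable_compensated.
move=> th th0; rewrite normr_id.
apply: le_trans (compensated_lipschitz _ _ _ l0 lm th0) _.
by apply: ler_wpM2r; [rewrite min_sqr_ge0// ltW|nra].
Qed.

(** The rate of change of E[p(Z)] per unit of time and of state: the moment Z^k contributes
    Phi(k). *)
Definition pgenerator (p : {poly R}) : R := \sum_(k < size p) p`_k * Phi k%:R.

(** The double root gives sum p_k = sum k p_k = 0, which removes alpha and the compensator, and sum
    (k^2 - k) p_k = p''(1) = 2 q(1), which is what beta multiplies. *)
Lemma pgeneratorE (q : {poly R}) (p := (1 - 'X) ^+ 2 * q) :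
  pgenerator p = 2 * beta * q.[1] + \int[pi]_(th in axis) p.[expR (- th)].
Proof.
have p1 : p.[1] = 0 by rewrite /p !hornerE subrr expr0n mul0r.
have du : (1 - 'X : {poly R})^`() = -1 by rewrite derivB derivX -polyC1 derivC sub0r.
have dn1 : (-1 : {poly R})^`() = 0 by rewrite derivN -polyC1 derivC oppr0.
have dp : p^`() = (-1 * (1 - 'X) + (1 - 'X) * -1) * q + (1 - 'X) * (1 - 'X) * q^`().
  by rewrite /p expr2 !derivM du.
have p'1 : p^`().[1] = 0.
  by rewrite dp !hornerE; ring.
have p''1 : p^`()^`().[1] = 2 * q.[1].
  rewrite dp derivD !derivM derivD !derivM du dn1 !hornerE /=; ring.
transitivity (\sum_(k < size p) (alpha * (p`_k * k%:R) +
    (beta * (p`_k * (k%:R ^+ 2 - k%:R)) + beta * (p`_k * k%:R)) +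
     p`_k * \int[pi]_(th in axis) compensated k%:R th)).
  by apply: eq_bigr => k _; rewrite mechanismE /nonlinear_part; ring.
rewrite !big_split/= -!mulr_sumr -deriv_horner1 -deriv2_horner1 p'1 p''1.
rewrite !mulr0 addr0 add0r mulrCA -mulrA; congr (_ + _).
rewrite -(@Rintegral_lincomb _ _ _ pi axis _ (fun k => p`_k)
  (fun k th => compensated k%:R th))//; last by move=> k; exact: integrable_compensated.
apply: eq_Rintegral => th _.
transitivity (\sum_(k < size p)
    (p`_k * expR (- th) ^+ k - p`_k * 1 ^+ k + th * (p`_k * k%:R))).
  by apply: eq_bigr => k _; rewrite /compensated expr1n -expRM_natl mulrN; ring.
rewrite big_split/= -mulr_sumr -deriv_horner1 p'1 mulr0 addr0 big_split/= sumrN.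
by rewrite -!horner_coef p1 subr0.
Qed.

End LevyMeasure.

Arguments levy_mass {R} pi.
Arguments nonlinear_part {R} beta pi l.
Arguments pgenerator {R} alpha beta pi p.

(** * The cumulant as a differentiable function of time *)

Section Cumulant.
Context {R : realType} {alpha beta : R}
  { pi : {sigma_finite_measure set R -> \bar R} }.
Hypothesis bp : branching_parameters alpha beta pi.
Notation Phi := (branching_mechanism alpha beta pi).
Context {l : R} {w : R -> R}.
Hypothesis l0 : 0 <= l.
Hypothesis wl : cumulant_solution Phi l w.

(** The equation says nothing about [w] at negative times, so the calculus is done on its right-hand
    side, which agrees with [w] on [0, oo). *)
Let W (t : R) : R := l - \int[lebesgue_measure]_(s in `[0, t]) Phi (w s).

Let WE t : 0 <= t -> W t = w t.
Proof. by move=> t0; rewrite (cumulant_equation wl). Qed.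

Let W0 : W 0 = l.
Proof. by rewrite /W set_itv1 Rintegral_set1 subr0. Qed.

Let W_continuous (t : R) : 0 <= t -> {within `[0, t], continuous W}.
Proof.
move=> t0 x; apply: cvgB; first exact: cvg_cst.
exact: (parameterized_integral_continuous t0 (cumulant_integrable wl t0)).
Qed.

(** Bootstrap: integrability alone makes [W] continuous, the Lipschitz bound carries this over to
    [Phi \o w], and then the fundamental theorem of calculus applies. *)
Let Phi_w_continuous (t : R) : 0 < t -> {for t, continuous (Phi \o w)}.
Proof.
move=> t0; have T0 : 0 <= t + 1 by lra.
have [M hM] := cumulant_locally_bounded wl T0.
have [C C0 hC] := mechanism_lipschitz bp M.
have Wt : {for t, continuous W}.
  have := W_continuous _ T0; rewrite continuous_within_itvP; last lra.
  by move=> [+ _ _]; apply; rewrite in_itv/=; apply/andP; split; lra.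
apply/cvgrPdist_le => e e0.
(* [C + 1] rather than [C], which may be 0. *)
have d0 : 0 < e / (C + 1) by rewrite divr_gt0//; lra.
have /cvgrPdist_le/(_ _ d0) := Wt; apply: filter_app.
near=> s => Ws.
have s0 : 0 < s by near: s; exact: lt_nbhsr.
have s1 : s <= t + 1 by apply: ltW; near: s; apply: lt_nbhsl; lra.
rewrite /= distrC; apply: le_trans (hC _ _ _ _) _.
- by rewrite (cumulant_ge0 wl (ltW t0)) hM//; lra.
- by rewrite (cumulant_ge0 wl (ltW s0)) hM//; lra.
rewrite -!WE; [|lra..]; rewrite distrC.
apply: (@le_trans _ _ (C * (e / (C + 1)))); first exact: ler_wpM2l.
rewrite mulrA ler_pdivrMr; nra.
Unshelve. all: by end_near. Qed.

Let W_derive (t : R) : 0 < t -> is_derive t 1 W (- Phi (w t)).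
Proof.
move=> t0.
have T0 : 0 <= t + 1 by lra.
have tT : t < t + 1 by lra.
have [dF F'] := @continuous_FTC1_closed _ (Phi \o w) 0 t _ tT
  (cumulant_integrable wl T0) t0 (Phi_w_continuous _ t0).
have dF' : is_derive t 1
    (fun x : R => \int[lebesgue_measure]_(s in `[0, x]) (Phi \o w) s) (Phi (w t)).
  by split; [exact: dF|rewrite -derive1E].
rewrite -[- Phi _]add0r.
exact: is_deriveD.
Qed.

Lemma cumulant_start : w 0 = l.
Proof. by rewrite -WE. Qed.

Lemma cumulant_mvt (t : R) : 0 < t ->
  exists2 c, 0 < c < t & w t = l - Phi (w c) * t.
Proof.
move=> t0.
have [||c] := @MVT _ W (fun s => - Phi (w s)) 0 t t0.
- by move=> x; rewrite in_itv/= => /andP[x0 _]; exact: W_derive.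
- by apply: W_continuous; lra.
rewrite in_itv/= subr0 W0 WE; last lra.
by move=> ct h; exists c => //; lra.
Qed.

(* The exponentially tilted solution has derivative
   [- expR (alpha * s) * nonlinear_part (w s)]. *)
Lemma cumulant_tilted_mvt (t : R) : 0 < t ->
  exists2 c, 0 < c < t &
    expR (alpha * t) * w t =
    l - expR (alpha * c) * nonlinear_part beta pi (w c) * t.
Proof.
move=> t0.
have [||c] := @MVT _ (fun s => expR (alpha * s) * W s)
  (fun s => - (expR (alpha * s) * nonlinear_part beta pi (w s))) 0 t t0.
- move=> x; rewrite in_itv/= => /andP[x0 _].
  have dE : is_derive x 1 (fun s : R => expR (alpha * s)) (alpha * expR (alpha * x)).
    have da : is_derive x 1 (alpha \*: (id : R -> R)) (alpha *: (1 : R)).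
      exact: is_deriveZ.
    have := is_derive1_comp (is_derive_expR (alpha * x)) da.
    by move/is_derive_eq; apply; rewrite /GRing.scale/= mulr1 mulrC.
  have := is_deriveM dE (W_derive _ x0).
  move/is_derive_eq; apply.
  rewrite WE; last lra.
  rewrite mechanismE /GRing.scale/=; ring.
- move=> x; apply: cvgM; last by apply: W_continuous; lra.
  apply: continuous_subspaceT => y; apply: continuous_comp.
    exact: mulrl_continuous.
  exact: continuous_expR.
rewrite in_itv/= subr0 W0 WE; last lra.
by rewrite mulr0 expR0 => ct h; exists c => //; lra.
Qed.

(** The tilted solution has nonpositive derivative, so it stays below its initial value l. *)
Lemma cumulant_le (t : R) : 0 <= t -> w t <= l * expR (- (alpha * t)).
Proof.
rewrite le_eqVlt => /predU1P[<-|t0].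
  by rewrite cumulant_start mulr0 oppr0 expR0 mulr1.
have [c /andP[c0 _] h] := cumulant_tilted_mvt _ t0.
rewrite expRN ler_pdivlMr ?expR_gt0// mulrC h gerBl; apply: mulr_ge0; last lra.
rewrite mulr_ge0 ?expR_ge0//; apply: (nonlinear_part_ge0 bp).
by apply: (cumulant_ge0 wl); lra.
Qed.

(** As long as [w] stays in [0, d], the tilted solution decreases at rate at most e l. The last
    hypothesis keeps [w] there up to time t, by [cumulant_le]. *)
Lemma cumulant_ge (t e d : R) : 0 <= t -> 0 <= e ->
  (forall m, 0 <= m <= d -> nonlinear_part beta pi m <= e * m) ->
  l * expR (`|alpha| * t) <= d ->
  l * (1 - e * t) * expR (- (alpha * t)) <= w t.
Proof.
rewrite le_eqVlt => /predU1P[<- _ _ _|t0 e0 he ld].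
  by rewrite cumulant_start !mulr0 subr0 oppr0 expR0 !mulr1.
have [c /andP[c0 ct] h] := cumulant_tilted_mvt _ t0.
have c0' := ltW c0.
rewrite expRN ler_pdivrMr ?expR_gt0// [leRHS]mulrC h.
have wc := cumulant_le _ c0'.
have wcd : w c <= d.
  apply: le_trans wc _; apply: le_trans ld; apply: ler_wpM2l => //.
  rewrite ler_expR -mulNr; apply: (@le_trans _ _ (`|alpha| * c)).
    by apply: ler_wpM2r => //; rewrite -normrN; exact: ler_norm.
  by apply: ler_wpM2l; [exact: normr_ge0|exact: ltW].
have wc0 := cumulant_ge0 wl c0'.
have k1 : nonlinear_part beta pi (w c) <= e * w c by apply: he; rewrite wc0.
have k2 : expR (alpha * c) * w c <= l.
  by move: wc; rewrite expRN ler_pdivlMr ?expR_gt0// mulrC.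
have k3 : expR (alpha * c) * nonlinear_part beta pi (w c) <= e * l.
  apply: (@le_trans _ _ (expR (alpha * c) * (e * w c))).
    by apply: ler_wpM2l => //; exact: expR_ge0.
  by rewrite mulrCA; apply: ler_wpM2l.
nra.
Qed.

(** The mean value theorem is used twice: w moves by O(h) on [0, h], so Phi(w) is Phi(l) + O(h)
    there, and one more factor h makes the error O(h^2). *)
Lemma cumulant_small_time : exists2 C, 0 <= C &
  forall h, 0 <= h <= 1 -> `|w h - l + h * Phi l| <= C * h ^+ 2.
Proof.
have [M hM] := cumulant_locally_bounded wl (@ler01 R).
have [C C0 hC] := mechanism_lipschitz bp M.
have wM s : 0 <= s <= 1 -> 0 <= w s <= M.
  by move=> s01; rewrite hM// (cumulant_ge0 wl)//; case/andP: s01.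
have lM : 0 <= l <= M by rewrite -cumulant_start wM// lexx ler01.
have M0 : 0 <= M by lra.
pose B := `|Phi l| + C * M.
have hB s : 0 <= s <= 1 -> `|Phi (w s)| <= B.
  move=> s01; rewrite -[Phi (w s)](subrK (Phi l)) addrC.
  apply: le_trans (ler_normD _ _) _; rewrite lerD2l.
  apply: le_trans (hC _ _ lM (wM _ s01)) _; apply: ler_wpM2l => //.
  have := wM _ s01; move: lM => /andP[? ?] /andP[? ?]; rewrite ler_norml.
  by apply/andP; split; lra.
have B0 : 0 <= B by rewrite addr_ge0// mulr_ge0.
exists (C * B); first exact: mulr_ge0.
move=> h /andP[h0 h1].
move: h0; rewrite le_eqVlt => /predU1P[<-|h0].
  by rewrite cumulant_start subrr mul0r addr0 normr0 mulr_ge0 ?sqr_ge0// mulr_ge0.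
have [c /andP[c0 ch] ->] := cumulant_mvt _ h0.
have [c' /andP[c'0 c'c] hc] := cumulant_mvt _ c0.
have c'1 : 0 <= c' <= 1 by apply/andP; split; lra.
have c1 : 0 <= c <= 1 by apply/andP; split; lra.
rewrite (_ : _ - _ - _ + _ = - ((Phi (w c) - Phi l) * h)); last by ring.
rewrite normrN normrM (gtr0_norm h0) expr2 mulrA; apply: ler_wpM2r; first lra.
apply: le_trans (hC _ _ lM (wM _ c1)) _; rewrite -mulrA; apply: ler_wpM2l => //.
rewrite hc (_ : l - _ - l = - (Phi (w c') * c)); last by ring.
rewrite normrN normrM (gtr0_norm c0); apply: ler_pM => //.
- exact: ltW.
- exact: hB.
- exact: ltW.
Qed.

End Cumulant.

(** * Jumps of rcll paths and increments over fine grids *)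

Section GridIncrements.
Context {R : realType}.
Implicit Types (f : R -> R) (r s t u : R).

Definition grid_increment f (h : R) (i : nat) : R :=
  f (i%:R * h + h) - f (i%:R * h).

Lemma rcll_right f s : rcll f -> 0 <= s -> forall e, 0 < e ->
  exists2 d, 0 < d & forall u, s <= u -> u < s + d -> `|f s - f u| < e.
Proof.
move=> [fr _] s0 e e0.
have /cvgrPdist_lt/(_ _ e0)[d /= d0 hd] := fr _ s0.
exists d => // u; rewrite le_eqVlt => /predU1P[<- _|su ud].
  by rewrite subrr normr0.
apply: hd => //=; rewrite ltr0_norm ?opprB; lra.
Qed.

Lemma rcll_left f s : rcll f -> 0 < s -> forall e, 0 < e ->
  exists2 d, 0 < d & forall u, s - d < u -> u < s ->
    `|f s - jump f s - f u| < e.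
Proof.
move=> [_ fl] s0 e e0.
have /cvgrPdist_lt/(_ _ e0)[d /= d0 hd] := fl _ s0.
exists d => // u ud us.
rewrite (_ : f s - jump f s = lim (f u @[u --> s^'-])); last by rewrite /jump; ring.
by apply: hd => //=; rewrite gtr0_norm; lra.
Qed.

Lemma near_infty_step t (d : R) : 0 < d -> \forall n \near \oo, t / n.+1%:R < d.
Proof.
move=> d0; have : t * n.+1%:R^-1 @[n --> \oo] --> (0 : R).
  by rewrite -[X in _ --> X](mulr0 t); apply: cvgM;
    [exact: cvg_cst|exact: cvg_harmonic].
move=> /cvgrPdist_lt/(_ _ d0); apply: filterS => n /=.
by rewrite sub0r normrN; apply: le_lt_trans; exact: ler_norm.
Qed.

(** The cell ending at the first grid point at or after s begins strictly before s. On a fine grid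
    each of its ends is within half the excess [jump f s - r] of the matching one-sided value of
    f. *)
Lemma jump_grid_increment f s t r : rcll f -> 0 < s <= t -> r < jump f s ->
  \forall n \near \oo,
    exists2 i, (i < n.+1)%N & r < grid_increment f (t / n.+1%:R) i.
Proof.
move=> rf /andP[s0 st] rj.
have e0 : 0 < (jump f s - r) / 2 by lra.
have [d1 d10 h1] := rcll_right _ _ rf (ltW s0) _ e0.
have [d2 d20 h2] := rcll_left _ _ rf s0 _ e0.
have d0 : 0 < Num.min d1 d2 by rewrite lt_min d10.
apply: filterS (near_infty_step t _ d0) => n.
rewrite lt_min => /andP[]; set h := t / _ => hd1 hd2.
have t0 : 0 < t by lra.
have h0 : 0 < h by rewrite divr_gt0.
have ex : exists i : nat, s <= i%:R * h + h.
  by exists n; rewrite -[X in _ + X]mul1r -mulrDl natr1 mulrC divfK// pnatr_eq0.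
case: (ex_minnP ex) => i si imin.
have is_ : i%:R * h < s.
  rewrite ltNge; apply/negP => sih; case: i => [|i] in si imin sih *.
    by move: sih; rewrite mul0r; lra.
  have := imin i; rewrite ltnn => H; have : s <= i%:R * h + h.
    by move: sih; rewrite -natr1 mulrDl mul1r.
  by move=> /H.
exists i; last first.
  have := h1 _ si; have := h2 (i%:R * h); rewrite /grid_increment.
  move=> /(_ _ is_); rewrite ltr_norml => H2; rewrite ltr_norml => H1.
  have /andP[a1 a2] := H2 ltac:(lra). have /andP[a3 a4] := H1 ltac:(lra).
  lra.
apply: imin; rewrite -[X in _ + X]mul1r -mulrDl natr1 mulrC divfK// pnatr_eq0//.
Qed.

(** Here f x - j plays the left limit at x. An increment on one side of x is below 2e <= r, and one
    that straddles x is below j + 2e <= r. *)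
Lemma small_increment f (x j r e D h u : R) : e <= (r - j) / 2 -> e <= r / 2 ->
  (forall y, x <= y -> y < x + D -> `|f x - f y| < e) ->
  (forall y, 0 <= y -> x - D < y -> y < x -> `|f x - j - f y| < e) ->
  0 <= u -> 0 < h -> h < D / 2 -> u < x + D / 2 -> x - D / 2 < u ->
  f (u + h) - f u < r.
Proof.
move=> e1 e2 h1 h2 u0 h0 hD ux1 ux2.
have uD : x - D < u by lra.
have uhD : u + h < x + D by lra.
have [xu|ux] := leP x u.
  have /ltr_normlP[_ a2] := h1 u xu ltac:(lra).
  have /ltr_normlP[a3 _] := h1 (u + h) ltac:(lra) uhD.
  lra.
have /ltr_normlP[a1 a2] := h2 u u0 uD ux.
have [xu|ux'] := leP x (u + h).
  by have /ltr_normlP[a3 a4] := h1 (u + h) xu uhD; lra.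
by have /ltr_normlP[a3 a4] := h2 (u + h) ltac:(lra) ltac:(lra) ux'; lra.
Qed.

(* Compactness of [0, t]: each point has a neighbourhood in which all short
   increments are below [r]. *)
Lemma grid_increment_jump f t r : rcll f -> 0 < t -> 0 < r ->
  (forall s, 0 < s <= t -> jump f s < r) ->
  \forall n \near \oo, forall i, (i < n.+1)%N ->
    grid_increment f (t / n.+1%:R) i < r.
Proof.
move=> rf t0 r0 jr.
have /compact_near_coveringP cov := @segment_compact R 0 t.
have H : \forall n \near \oo, `[0, t] `<=`
    (fun u => 0 <= u -> f (u + t / n.+1%:R) - f u < r).
  apply: cov => x; rewrite /= in_itv/= => /andP[x0 xt].
  (* At 0 the left limit would involve negative times, which are uncontrolled; the left-hand
     condition is then vacuous on [0, t], and 0 serves as the jump. *)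
  pose j := if x == 0 then 0 else jump f x.
  have jr' : j < r.
    rewrite /j; case: eqVneq => // xn0; apply: jr; rewrite xt andbT.
    by rewrite lt_neqAle eq_sym xn0.
  pose e := Num.min ((r - j) / 2) (r / 2).
  have e0 : 0 < e by rewrite lt_min; apply/andP; split; lra.
  have [e1 e2] : e <= (r - j) / 2 /\ e <= r / 2 by rewrite !ge_min !lexx orbT.
  have [d1 d10 h1] := rcll_right _ _ rf x0 _ e0.
  have [d2 d20 h2] : exists2 d, 0 < d & forall u, 0 <= u -> x - d < u -> u < x ->
      `|f x - j - f u| < e.
    rewrite /j; case: eqVneq => [->|xn0].
      by exists 1 => // u u0 _ /(le_lt_trans u0); rewrite ltxx.
    have x0' : 0 < x by rewrite lt_neqAle eq_sym xn0.
    have [d d0 hd] := rcll_left _ _ rf x0' _ e0.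
    by exists d => // u _; exact: hd.
  have d0 : 0 < Num.min d1 d2 / 2 by rewrite divr_gt0// lt_min d10.
  have [q1 q2] : Num.min d1 d2 <= d1 /\ Num.min d1 d2 <= d2.
    by rewrite !ge_min !lexx orbT.
  near=> u n => /= u0.
  apply: (small_increment _ x j r e (Num.min d1 d2)) => //.
  - by move=> y xy yD; apply: h1 => //; apply: lt_le_trans yD _; rewrite lerD2l.
  - by move=> y y0 yD; apply: h2 => //; apply: le_lt_trans yD; rewrite lerD2l lerN2.
  - by rewrite divr_gt0.
  - by near: n; exact: near_infty_step.
  - by near: u; apply: lt_nbhsl; rewrite ltrDl.
  - by near: u; apply: lt_nbhsr; rewrite ltrBlDr ltrDl.
apply: filterS H => n H i iN.
have h0 : 0 < t / n.+1%:R by rewrite divr_gt0.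
have ih0 : 0 <= i%:R * (t / n.+1%:R) by rewrite mulr_ge0// ltW.
apply: H => //=; rewrite in_itv/= ih0/=.
rewrite mulrCA ger_pMr// ler_pdivrMr// mul1r ler_nat; exact: ltnW.
Unshelve. all: by end_near. Qed.

Lemma sup_jump_gtP f t r :
  (r%:E < sup_jump f t)%E <-> exists2 s, 0 < s <= t & r < jump f s.
Proof.
split=> [|[s s0 rs]].
  by move=> /ereal_sup_gt[_ [s +] <-]; rewrite /= in_itv/= lte_fin => s0 rs; exists s.
apply: (@lt_le_trans _ _ (jump f s)%:E); first by rewrite lte_fin.
by apply: ereal_sup_ubound; exists s => //=; rewrite in_itv.
Qed.

Definition grid_exceed f t r (n : nat) : Prop :=
  exists2 i, (i < n.+1)%N & r < grid_increment f (t / n.+1%:R) i.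

Lemma sup_jump_grid f t r : rcll f -> (r%:E < sup_jump f t)%E ->
  exists k : nat, \forall n \near \oo, grid_exceed f t (r + k.+1%:R^-1) n.
Proof.
move=> rf /sup_jump_gtP[s s0 rs].
have e0 : 0 < jump f s - r by lra.
exists (Num.truncn (jump f s - r)^-1); apply: (jump_grid_increment _ _ _ _ rf s0).
rewrite addrC -ltrBrDr -[ltRHS]invrK ltf_pV2 ?posrE ?invr_gt0//.
exact: truncnS_gt.
Qed.

(** If no jump exceeds r, all jumps are strictly below r + 1/(k+1), so fine grids have no increment
    above that level. The margin is essential, since a jump may equal r. Arbitrarily fine grids
    suffice here, whereas [sup_jump_grid] yields all fine ones. *)
Lemma grid_sup_jump f t r k : rcll f -> 0 < t -> 0 < r ->
  (forall N : nat, exists2 n, (N <= n)%N & grid_exceed f t (r + k.+1%:R^-1) n) ->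
  (r%:E < sup_jump f t)%E.
Proof.
move=> rf t0 r0 H; apply/sup_jump_gtP; apply: contrapT => nj.
have k0 : 0 < k.+1%:R^-1 :> R by rewrite invr_gt0.
have [||N _ HN] := grid_increment_jump _ t (r + k.+1%:R^-1) rf t0.
- exact: addr_gt0.
- move=> s s0; rewrite ltNge; apply/negP => rs; apply: nj; exists s => //.
  by apply: lt_le_trans rs; rewrite ltrDl.
have [n Nn [i iN]] := H N.
by apply/negP; rewrite -leNgt ltW// HN.
Qed.

End GridIncrements.

(** * Approximation of weighted integrals by integrals over superlevel sets *)

Section LayerCake.
Context {d : measure_display} {T : measurableType d} {R : realType}.
Implicit Types (P : probability T R) (A : set T) (f U : T -> R).

Lemma bounded_integrable P A f (M : R) : measurable A ->
  measurable_fun setT f -> (forall w, A w -> `|f w| <= M) ->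
  P.-integrable A (EFin \o f).
Proof.
move=> mA mf fM; apply: measurable_bounded_integrable => //.
- by apply: le_lt_trans (probability_le1 P mA) _; rewrite ltry.
- exact: measurable_funS mf.
- by exists M; split; [exact: num_real|move=> y My w Aw; apply/ltW/le_lt_trans/My/fM].
Qed.

(** For c in [0, 1] this is floor(nc)/n, written with indicators so that a weight becomes an average
    of restrictions to events. *)
Definition staircase (n : nat) (c : R) : R :=
  n%:R^-1 * \sum_(j < n) (j.+1%:R <= n%:R * c)%R%:R.

Lemma staircase_le (n : nat) (c : R) : (0 < n)%N -> 0 <= c <= 1 ->
  c - n%:R^-1 <= staircase n c <= c.
Proof.
move=> n0 /andP[c0 c1]; have n0' : 0 < n%:R :> R by rewrite ltr0n.
have nc0 : 0 <= n%:R * c by rewrite mulr_ge0// ltW.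
set m := Num.truncn (n%:R * c).
have /andP[m1 m2] : m%:R <= n%:R * c < m.+1%:R by exact: truncn_itv.
have mn : (m <= n)%N.
  rewrite -(ler_nat R); apply: le_trans m1 _; rewrite ger_pMr//.
have -> : staircase n c = n%:R^-1 * m%:R.
  congr (_ * _).
  rewrite (eq_bigr (fun j : 'I_n => (j < m)%N%:R)); last first.
    move=> j _; congr (_ %:R); congr nat_of_bool; apply/idP/idP => [h|h].
      by rewrite -ltnS -(ltr_nat R); apply: le_lt_trans m2.
    by apply: le_trans m1; rewrite ler_nat.
  rewrite -natr_sum -(big_mkord xpredT (fun j => (j < m)%N : nat)).
  have -> k : (\sum_(0 <= i < k) (i < m) = minn k m)%N.
    elim: k => [|k IH]; first by rewrite big_nil min0n.
    by rewrite big_nat_recr//= IH; lia.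
  by rewrite (minn_idPr mn).
apply/andP; split; last by rewrite mulrC ler_pdivrMr// mulrC.
by rewrite lerBlDr -[X in _ + X]mulr1 -mulrDr mulrC natr1 ler_pdivlMr// mulrC ltW.
Qed.

(** It serves in two ways: f = 1 turns the expectation of U into probabilities, and a general f
    turns a weighted integral into integrals over events. *)
Lemma Rintegral_staircase P A f U n : (0 < n)%N -> measurable A ->
  measurable_fun setT f -> measurable_fun setT U ->
  (forall w, A w -> `|f w| <= 1) -> (forall w, A w -> 0 <= U w <= 1) ->
  `|\int[P]_(w in A) (U w * f w) -
    n%:R^-1 * \sum_(j < n)
      \int[P]_(w in A `&` [set w | j.+1%:R <= n%:R * U w]) f w| <= n%:R^-1.
Proof.
move=> n0 mA mf mU f1 U1; have n0' : 0 < n%:R :> R by rewrite ltr0n.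
pose V j := [set w | j.+1%:R <= n%:R * U w].
have mV j : measurable (V j).
  rewrite -[V j]setTI.
  rewrite (_ : V j = (fun w => n%:R * U w) @^-1` `[j.+1%:R, +oo[%classic).
    by apply: (measurable_funM (measurable_cst _) mU).
  by apply/seteqP; split => w /=; rewrite in_itv/= andbT.
have mVf j : measurable_fun setT (fun w => \1_(V j) w * f w).
  by apply: measurable_funM.
have bVf j w : A w -> `|\1_(V j) w * f w| <= 1.
  move=> Aw; rewrite normrM indicE; case: (_ \in _); rewrite ?normr1 ?mul1r ?f1//.
  by rewrite normr0 mul0r.
have iVf j : P.-integrable A (EFin \o (fun w => \1_(V j) w * f w)).
  exact: (bounded_integrable P A _ 1 mA (mVf j) (bVf j)).
have -> : n%:R^-1 * \sum_(j < n) \int[P]_(w in A `&` V j) f w =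
   \int[P]_(w in A) (\sum_(j < n) n%:R^-1 * (\1_(V j) w * f w)).
  rewrite (Rintegral_lincomb P A mA (fun=> n%:R^-1)
    (fun j w => \1_(V j) w * f w))// mulr_sumr.
  apply: eq_bigr => j _; congr (_ * _).
  rewrite Rintegral_mkcondr; apply: eq_Rintegral => w _.
  by rewrite patch_indic/= mulrC.
have sE w : \sum_(j < n) n%:R^-1 * (\1_(V j) w * f w) = staircase n (U w) * f w.
  rewrite /staircase -mulrA mulr_suml mulr_sumr; apply: eq_bigr => j _.
  congr (_ * (_ * _)); rewrite indicE; congr (_ %:R); congr nat_of_bool.
  by apply/idP/idP => [/set_mem|h]; [|rewrite inE].
have iU : P.-integrable A (EFin \o (fun w => U w * f w)).
  apply: (bounded_integrable P A _ 1 mA); first exact: measurable_funM.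
  move=> w Aw; rewrite normrM; have /andP[u0 u1] := U1 _ Aw.
  by rewrite ger0_norm// mulr_ile1// f1.
have iS := integrable_lincomb P A mA (fun=> n%:R^-1)
  (fun j w => \1_(V j) w * f w) iVf n.
rewrite -RintegralB//.
have iB : P.-integrable A (EFin \o (fun w => U w * f w -
     \sum_(j < n) n%:R^-1 * (\1_(V j) w * f w))).
  exact: (integrableB mA iU iS).
apply: le_trans (le_normr_Rintegral mA iB) _.
apply: (@le_trans _ _ (\int[P]_(_ in A) n%:R^-1)); last first.
  rewrite Rintegral_cst// ler_piMr ?invr_ge0// -lee_fin fineK ?fin_num_measure//.
  exact: probability_le1.
apply: le_Rintegral => //.
- exact: integrable_norm.
- exact: finite_measure_integrable_cst.
- move=> w Aw; rewrite sE -mulrBl normrM.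
  have /andP[s1 s2] := staircase_le n (U w) n0 (U1 _ Aw).
  rewrite -[leRHS]mulr1; apply: ler_pM => //; last exact: f1.
  by rewrite ger0_norm; lra.
Qed.

Lemma eq_of_dist_invn (a b : R) (C : R) :
  (forall n, (0 < n)%N -> `|a - b| <= C * n%:R^-1) -> a = b.
Proof.
move=> H; apply/eqP; rewrite -subr_eq0 -normr_le0.
apply: (@le_trans _ _ (lim ((C * n.+1%:R^-1) @[n --> \oo]))); last first.
  rewrite (_ : lim _ = 0)//; apply/cvg_lim => //.
  by rewrite -[X in _ --> X](mulr0 C); apply: cvgM;
    [exact: cvg_cst|exact: cvg_harmonic].
apply: limr_ge.
  by apply: is_cvgM; [exact: is_cvg_cst|apply/cvg_ex; exists 0; exact: cvg_harmonic].
by apply: nearW => n; exact: H.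
Qed.

(** The pull-out rule of conditional expectation in integrated form: G plays the known sigma-algebra
    and U a weight measurable for it. *)
Lemma eq_Rintegral_weighted P (G : set (set T)) A f (g : T -> R) U :
  measurable A -> measurable_fun setT f -> measurable_fun setT g ->
  measurable_fun setT U ->
  (forall w, A w -> `|f w| <= 1) -> (forall w, A w -> `|g w| <= 1) ->
  (forall w, A w -> 0 <= U w <= 1) ->
  (forall c, G (A `&` [set w | c <= U w])) ->
  (forall B, G B -> \int[P]_(w in B) f w = \int[P]_(w in B) g w) ->
  \int[P]_(w in A) (U w * f w) = \int[P]_(w in A) (U w * g w).
Proof.
move=> mA mf mg mU f1 g1 U1 GU Gfg; apply: (eq_of_dist_invn _ _ 2) => n n0.
have Hf := Rintegral_staircase P _ _ _ _ n0 mA mf mU f1 U1.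
have Hg := Rintegral_staircase P _ _ _ _ n0 mA mg mU g1 U1.
move: Hf Hg.
rewrite (eq_bigr (fun j : 'I_n =>
  \int[P]_(w in A `&` [set w | j.+1%:R <= n%:R * U w]) g w)); last first.
  move=> j _; apply: Gfg.
  rewrite (_ : [set w | _] = [set w | j.+1%:R / n%:R <= U w]); first exact: GU.
  by apply/seteqP; split => w /=; rewrite ler_pdivrMr ?ltr0n// mulrC.
set S := n%:R^-1 * _; set a := Rintegral _ _ _; set b := Rintegral _ _ _ => Hf Hg.
rewrite (_ : a - b = (a - S) + (S - b)); last by ring.
apply: le_trans (ler_normD _ _) _; rewrite (distrC S); lra.
Qed.

End LayerCake.

(** * Events of the past of the process *)

Section Past.
Context {R : realType} {d : measure_display} {T : measurableType d}.
Context {X : R -> T -> R}.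

Lemma pastI (s : R) (A B : set T) : past X s A -> past X s B -> past X s (A `&` B).
Proof. exact: (@measurableI _ (g_sigma_algebraType _)). Qed.

Lemma pastC (s : R) (A : set T) : past X s A -> past X s (~` A).
Proof. exact: (@measurableC _ (g_sigma_algebraType _)). Qed.

Lemma pastT (s : R) : past X s setT.
Proof. exact: (@measurableT _ (g_sigma_algebraType _)). Qed.

(** Taking the past as the measurable structure of T gives access to the closure rules of measurable
    functions, hence to events about increments. *)
Lemma past_process (s u : R) : 0 <= u <= s ->
  measurable_fun [set: g_sigma_algebraType
     [set A : set T | exists (u : R) (B : set R),
        [/\ 0 <= u <= s, measurable B & A = X u @^-1` B]]] (X u).
Proof.
move=> us _ B mB; rewrite setTI; apply: sub_gen_smallest.
by exists u, B.
Qed.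

Lemma past_preimage (s u : R) (B : set R) : 0 <= u <= s -> measurable B ->
  past X s (X u @^-1` B).
Proof. by move=> us mB; apply: sub_gen_smallest; exists u, B. Qed.

Lemma past_increment (s u v r : R) : 0 <= u <= s -> 0 <= v <= s ->
  past X s [set w | r < X u w - X v w].
Proof.
move=> us vs.
have := measurable_funB (past_process _ _ us) (past_process _ _ vs).
move=> /(_ measurableT `]r, +oo[%classic (measurable_itv _)).
rewrite setTI; congr (past X s _).
by apply/seteqP; split => w /=; rewrite in_itv/= andbT.
Qed.

Lemma past_state_le (s r : R) : 0 <= s -> past X s [set w | X s w <= r].
Proof.
move=> s0; rewrite (_ : mkset _ = X s @^-1` `]-oo, r]%classic).
  by apply: past_preimage; rewrite ?s0 ?lexx//.
by apply/seteqP; split => w /=; rewrite in_itv.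
Qed.

Lemma subset_past (s u : R) : s <= u -> past X s `<=` past X u.
Proof.
move=> su; apply: smallest_sub; first exact: smallest_sigma_algebra.
move=> A [v [B [/andP[v0 vs] mB ->]]]; apply: past_preimage => //.
by rewrite v0 (le_trans vs).
Qed.

End Past.

(** * The Markov property for integrals of bounded functions *)

Section MarkovIntegrals.
Context {R : realType} {d : measure_display} {T : measurableType d}.
Context {X : R -> T -> R} {P : R -> probability T R}.
Hypothesis mp : markov_process X P.

Lemma past_measurable (s : R) (A : set T) : past X s A -> measurable A.
Proof.
move: A; apply: smallest_sub; first exact: sigma_algebra_measurable.
move=> A [v [B [/andP[v0 vs] mB ->]]]; rewrite -[_ @^-1` _]setTI.
exact: (process_measurable mp v0).
Qed.

Lemma measurable_process_comp (s : R) (g : R -> R) : 0 <= s ->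
  measurable_fun setT g -> measurable_fun setT (fun w => g (X s w)).
Proof. by move=> s0 mg; apply: measurableT_comp mg (process_measurable mp s0). Qed.

Lemma measurable_transition (s t : R) (B : set R) : 0 <= s -> 0 <= t ->
  measurable B -> measurable_fun setT (fun w => fine (P (X s w) (X t @^-1` B))).
Proof.
move=> s0 t0 mB; apply: measurableT_comp => //.
apply: (@measurable_comp _ _ _ _ _ _ (`[0, +oo[%classic : set R)
  (fun y => P y (X t @^-1` B)) setT (X s)) => //.
- by move=> _ [w _ <-] /=; rewrite in_itv/= andbT (process_ge0 mp).
- exact: (transition_measurable mp t0 mB).
- exact: (process_measurable mp).
Qed.

(** [markov_property] concerns events {X_(s+t) in B}; it is applied to the superlevel sets of g,
    whose average is within 1/n of g. The two sides thus differ by at most 2/n for every n. *)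
Lemma markov_integral (x s t : R) (A : set T) (g G : R -> R) :
  0 <= x -> 0 <= s -> 0 <= t -> past X s A ->
  measurable_fun setT g -> measurable_fun setT G ->
  (forall y, 0 <= y -> 0 <= g y <= 1) ->
  (forall y, 0 <= y -> \int[P y]_w g (X t w) = G y) ->
  \int[P x]_(w in A) g (X (s + t) w) = \int[P x]_(w in A) G (X s w).
Proof.
move=> x0 s0 t0 pA mg mG g01 gG.
have mA := past_measurable _ _ pA.
have st0 : 0 <= s + t by rewrite addr_ge0.
have X0 u w : 0 <= u -> 0 <= X u w by move=> u0; exact: (process_ge0 mp).
apply: (eq_of_dist_invn _ _ 2) => n n0.
pose B j := [set y : R | j.+1%:R <= n%:R * g y].
have mB j : measurable (B j).
  rewrite -[B j]setTI (_ : B j = (fun y => n%:R * g y) @^-1` `[j.+1%:R, +oo[%classic).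
    by apply: (measurable_funM (measurable_cst _) mg).
  by apply/seteqP; split => w /=; rewrite in_itv/= andbT.
have step (Q : probability T R) u A' : 0 <= u -> measurable A' ->
    `|\int[Q]_(w in A') g (X u w) -
    n%:R^-1 * \sum_(j < n) fine (Q (A' `&` X u @^-1` (B j)))| <= n%:R^-1.
  move=> u0 mA'.
  have := @Rintegral_staircase _ _ _ Q A' (cst 1) (fun w => g (X u w)) n n0 mA'.
  move=> /(_ (measurable_cst _) (measurable_process_comp _ _ u0 mg)).
  have -> : \int[Q]_(w in A') (g (X u w) * cst 1 w) = \int[Q]_(w in A') g (X u w).
    by apply: eq_Rintegral => w _; rewrite /= mulr1.
  rewrite (eq_bigr (fun j : 'I_n => fine (Q (A' `&` X u @^-1` (B j))))).
    by apply => w _ /=; rewrite ?normr1 ?g01// X0.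
  move=> j _; rewrite Rintegral_cst ?mul1r//; apply: measurableI => //.
  by have := process_measurable mp u0 measurableT (mB j); rewrite setTI.
pose h j w := fine (P (X s w) (X t @^-1` (B j))).
have mh j : measurable_fun setT (h j) by exact: measurable_transition.
have mXt u j : 0 <= u -> measurable (X u @^-1` (B j)).
  by move=> u0; have := process_measurable mp u0 measurableT (mB j); rewrite setTI.
have h1 j w : A w -> `|h j w| <= 1.
  move=> _; have mB' := mXt t j t0.
  by rewrite /h ger0_norm ?fine_ge0// -lee_fin fineK ?fin_num_measure// probability_le1.
have hE j : fine (P x (A `&` X (s + t) @^-1` (B j))) = \int[P x]_(w in A) h j w.
  rewrite (markov_property mp x0 s0 t0 pA (mB j)) /Rintegral /h.
  congr fine; apply: eq_integral => w _; rewrite fineK// fin_num_measure//.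
  exact: mXt.
have ih j : (P x).-integrable A (EFin \o h j).
  exact: (bounded_integrable (P x) A _ 1 mA (mh j) (h1 j)).
have H1 := step (P x) (s + t) A st0 mA.
rewrite (eq_bigr _ (fun j _ => hE (nat_of_ord j))) mulr_sumr in H1.
rewrite -(Rintegral_lincomb (P x) A mA (fun=> n%:R^-1) h ih n) in H1.
have iS := integrable_lincomb (P x) A mA (fun=> n%:R^-1) h ih n.
(* The same staircase under the law started at [X s w] recovers the conditional expectation G. *)
have H2 w : `|\sum_(j < n) n%:R^-1 * h j w - G (X s w)| <= n%:R^-1.
  have := step (P (X s w)) t setT t0 measurableT; rewrite gG ?X0// distrC mulr_sumr.
  by under eq_bigr do rewrite setTI.
have Gb w : A w -> `|G (X s w)| <= 1.
  move=> Aw; rewrite -gG ?X0//.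
  have ig : (P (X s w)).-integrable setT (EFin \o (fun w => g (X t w))).
    apply: (bounded_integrable _ _ _ 1 measurableT).
      exact: measurable_process_comp.
    by move=> w' _; have /andP[a b] := g01 (X t w') (X0 _ _ t0); rewrite ger0_norm.
  apply: le_trans (le_normr_Rintegral measurableT ig) _.
  apply: (@le_trans _ _ (\int[P (X s w)]_(_ in setT) 1)).
    apply: le_Rintegral => //.
    - exact: integrable_norm.
    - exact: finite_measure_integrable_cst.
    by move=> w' _; have /andP[a b] := g01 (X t w') (X0 _ _ t0); rewrite ger0_norm.
  by rewrite Rintegral_cst// mul1r -lee_fin fineK ?fin_num_measure// probability_le1.
have iG : (P x).-integrable A (EFin \o (fun w => G (X s w))).
  apply: (bounded_integrable _ _ _ 1 mA) => //; exact: measurable_process_comp.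
rewrite (_ : _ - _ = (\int[P x]_(w in A) g (X (s + t) w) -
    \int[P x]_(w in A) (\sum_(j < n) n%:R^-1 * h j w)) +
   (\int[P x]_(w in A) (\sum_(j < n) n%:R^-1 * h j w) -
    \int[P x]_(w in A) G (X s w))); last by ring.
apply: le_trans (ler_normD _ _) _; rewrite mulrDl mul1r; apply: lerD => //.
rewrite -RintegralB//.
have iB := integrableB mA iS iG.
apply: le_trans (le_normr_Rintegral mA iB) _.
apply: (@le_trans _ _ (\int[P x]_(_ in A) n%:R^-1)); last first.
  rewrite Rintegral_cst// ler_piMr ?invr_ge0// -lee_fin fineK ?fin_num_measure//.
  exact: probability_le1.
apply: le_Rintegral => //; [exact: integrable_norm|exact: finite_measure_integrable_cst].
Qed.

End MarkovIntegrals.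

(** * Short-time expansion of polynomial moments of Z *)

Section SmallTime.
Context {R : realType} {alpha beta : R}
  { pi : {sigma_finite_measure set R -> \bar R} }.
Hypothesis bp : branching_parameters alpha beta pi.
Notation Phi := (branching_mechanism alpha beta pi).
Notation L := (pgenerator alpha beta pi).
Context {v : R -> R -> R}.
Hypothesis vs : forall l, 0 <= l -> cumulant_solution Phi l (fun t => v t l).

Lemma cumulant_small_time_nat : exists c : nat -> R,
  forall k, 0 <= c k /\ forall h, 0 <= h <= 1 ->
    `|v h k%:R - k%:R + h * Phi k%:R| <= c k * h ^+ 2.
Proof.
have H (k : nat) : exists c, 0 <= c /\ forall h, 0 <= h <= 1 ->
    `|v h k%:R - k%:R + h * Phi k%:R| <= c * h ^+ 2.
  by have [C C0 hC] := cumulant_small_time bp (vs _ (ler0n R k)); exists C.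
by have [c hc] := choice H; exists c.
Qed.

(** The exponents are h y Phi(k) + O(h^2 y), the constants 1 cancel because p(1) = 0, and the
    quadratic remainder (hy)^2 is at most K h^2 y. The factor y kept in the error lets it be
    integrated against X_s. *)
Lemma small_time_expansion (p : {poly R}) (K : R) : p.[1] = 0 -> 0 <= K ->
  exists2 C, 0 <= C & forall h y, 0 <= h <= 1 -> 0 <= y <= K ->
    `|\sum_(k < size p) p`_k * expR (- (y * (v h k%:R - k%:R))) - h * y * L p|
      <= C * h ^+ 2 * y.
Proof.
move=> p1 K0; have [c hc] := cumulant_small_time_nat.
pose a k := `|Phi k%:R| + c k.
have a0 k : 0 <= a k by rewrite addr_ge0//; case: (hc k).
have c0 k : 0 <= c k by case: (hc k).
pose b k := `|p`_k| * (expR (K * a k) * K * a k ^+ 2 + c k).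
exists (\sum_(k < size p) b k).
  apply: sumr_ge0 => k _; rewrite mulr_ge0// addr_ge0//.
  by rewrite !mulr_ge0// ?expR_ge0// sqr_ge0.
move=> h y /andP[h0 h1] /andP[y0 yK].
have sp : \sum_(k < size p) p`_k = 0.
  by rewrite -[RHS]p1 horner_coef; apply: eq_bigr => k _; rewrite expr1n mulr1.
pose u k := - (y * (v h k%:R - k%:R)).
have -> : \sum_(k < size p) p`_k * expR (- (y * (v h k%:R - k%:R))) - h * y * L p =
    \sum_(k < size p) p`_k * (expR (u k) - 1 - h * y * Phi k%:R).
  transitivity (\sum_(k < size p)
      (p`_k * expR (u k) - p`_k - h * y * (p`_k * Phi k%:R))).
    by rewrite /pgenerator !big_split/= !sumrN sp -mulr_sumr; ring.
  by apply: eq_bigr => k _; ring.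
apply: le_trans (ler_norm_sum _ _ _) _; rewrite !mulr_suml; apply: ler_sum => k _.
rewrite normrM /b -[_ * h ^+ 2]mulrA -[leRHS]mulrA.
apply: ler_wpM2l; first exact: normr_ge0.
have [ck hk] := hc k; have := hk h; rewrite h0 h1 => /(_ isT).
set rho := _ + h * Phi _ => hrho.
have uE : u k = h * y * Phi k%:R - y * rho by rewrite /u /rho; ring.
have hh : h ^+ 2 <= h by rewrite expr2 ler_piMl.
have hy0 : 0 <= h * y by rewrite mulr_ge0.
have yrho : `|y * rho| <= c k * h ^+ 2 * y.
  by rewrite normrM ger0_norm// mulrC ler_wpM2r.
have hu : `|u k| <= a k * (h * y).
  rewrite uE; apply: le_trans (ler_normB _ _) _; rewrite /a mulrDl; apply: lerD.
    by rewrite normrM [`|h * y|]ger0_norm// mulrC.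
  apply: le_trans yrho _; rewrite -mulrA; apply: ler_wpM2l => //.
  exact: ler_wpM2r.
have huK : `|u k| <= K * a k.
  apply: le_trans hu _; rewrite mulrC; apply: ler_wpM2r => //.
  by rewrite -[K]mul1r; apply: ler_pM.
have e1 := dist_expR1D_le _ _ huK.
have e2 : u k ^+ 2 <= a k ^+ 2 * (K * (h ^+ 2 * y)).
  rewrite -[u k ^+ 2]real_normK ?num_real//.
  apply: (@le_trans _ _ ((a k * (h * y)) ^+ 2)).
    by apply: lerXn2r; rewrite ?nnegrE ?mulr_ge0.
  rewrite !exprMn; apply: ler_wpM2l; first exact: sqr_ge0.
  rewrite [leRHS]mulrCA; apply: ler_wpM2l; first exact: sqr_ge0.
  by rewrite expr2; apply: ler_wpM2r.
have -> : expR (u k) - 1 - h * y * Phi k%:R = (expR (u k) - 1 - u k) - y * rho.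
  by rewrite uE; ring.
apply: le_trans (ler_normB _ _) _; rewrite !mulrDl; apply: lerD => //.
rewrite (_ : _ * h ^+ 2 * y = expR (K * a k) * (a k ^+ 2 * (K * (h ^+ 2 * y))));
  last by ring.
by apply: le_trans e1 _; apply: ler_wpM2l => //; exact: expR_ge0.
Qed.

(** Cruder than the expansion, but uniform for states up to 1/h: hy <= 1 keeps the exponents
    bounded, so that e^u - 1 = O(u) suffices. *)
Lemma small_time_bound (p : {poly R}) : p.[1] = 0 ->
  exists2 C, 0 <= C & forall h y, 0 <= h <= 1 -> 0 <= y -> h * y <= 1 ->
    \sum_(k < size p) p`_k * expR (- (y * (v h k%:R - k%:R))) <= C * (h * y).
Proof.
move=> p1; have [c hc] := cumulant_small_time_nat.
pose a k := `|Phi k%:R| + c k.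
have a0 k : 0 <= a k by rewrite addr_ge0//; case: (hc k).
have c0 k : 0 <= c k by case: (hc k).
pose b k := `|p`_k| * (expR (a k) * a k).
exists (\sum_(k < size p) b k).
  by apply: sumr_ge0 => k _; rewrite mulr_ge0// mulr_ge0// expR_ge0.
move=> h y /andP[h0 h1] y0 hy1.
have sp : \sum_(k < size p) p`_k = 0.
  by rewrite -[RHS]p1 horner_coef; apply: eq_bigr => k _; rewrite expr1n mulr1.
pose u k := - (y * (v h k%:R - k%:R)).
have -> : \sum_(k < size p) p`_k * expR (- (y * (v h k%:R - k%:R))) =
    \sum_(k < size p) p`_k * (expR (u k) - 1).
  transitivity (\sum_(k < size p) (p`_k * expR (u k) - p`_k)).
    by rewrite big_split/= sumrN sp subr0.
  by apply: eq_bigr => k _; ring.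
rewrite mulr_suml; apply: ler_sum => k _.
apply: le_trans (ler_norm _) _.
rewrite normrM /b -!mulrA; apply: ler_wpM2l; first exact: normr_ge0.
have [ck hk] := hc k; have := hk h; rewrite h0 h1 => /(_ isT).
set rho := _ + h * Phi _ => hrho.
have uE : u k = h * y * Phi k%:R - y * rho by rewrite /u /rho; ring.
have hh : h ^+ 2 <= h by rewrite expr2 ler_piMl.
have hy0 : 0 <= h * y by rewrite mulr_ge0.
have hu : `|u k| <= a k * (h * y).
  rewrite uE; apply: le_trans (ler_normB _ _) _; rewrite /a mulrDl; apply: lerD.
    by rewrite normrM [`|h * y|]ger0_norm// mulrC.
  rewrite normrM ger0_norm// mulrA [leRHS]mulrC; apply: ler_wpM2l => //.
  by apply: le_trans hrho _; apply: ler_wpM2l.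
have hua : `|u k| <= a k by apply: le_trans hu _; rewrite ler_piMr.
by apply: le_trans (dist_expR1_le _ _ hua) _; apply: ler_wpM2l => //.
Qed.

Context {d : measure_display} {T : measurableType d}.
Context {X : R -> T -> R} {P : R -> probability T R}.
Hypothesis mp : markov_process X P.
Hypothesis lap : forall x t l : R, 0 <= x -> 0 <= t -> 0 <= l ->
  ('E_(P x)[(fun w => expR (- (l * X t w)))] = (expR (- (x * v t l)))%:E)%E.

Lemma Rintegral_laplace (x t l : R) : 0 <= x -> 0 <= t -> 0 <= l ->
  \int[P x]_w expR (- (l * X t w)) = expR (- (x * v t l)).
Proof.
by move=> x0 t0 l0; have := lap _ _ _ x0 t0 l0; rewrite unlock /Rintegral => ->.
Qed.

Lemma state_ge0 (s : R) w : 0 <= s -> 0 <= X s w.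
Proof. exact: (process_ge0 mp). Qed.

Lemma measurable_state (s : R) : 0 <= s -> measurable_fun setT (X s).
Proof. exact: (process_measurable mp). Qed.

Lemma cumulant_nat_ge0 (h : R) (k : nat) : 0 <= h -> 0 <= v h k%:R.
Proof. exact: (cumulant_ge0 (vs _ (ler0n R k))). Qed.

Section Window.
Variables (x s h K : R) (A : set T).
Hypotheses (x0 : 0 <= x) (s0 : 0 <= s) (h0 : 0 <= h).
Hypotheses (pA : past X s A) (AK : forall w, A w -> X s w <= K).

Let sh0 : 0 <= s + h. Proof. exact: addr_ge0. Qed.
Let mA : measurable A. Proof. exact: (past_measurable mp _ _ pA). Qed.
Let mE (u l : R) : 0 <= u -> measurable_fun setT (fun w => expR (l * X u w)).
Proof.
move=> u0; apply: measurableT_comp => //; apply: measurable_funM => //.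
exact: measurable_state.
Qed.

Definition exp_decrement w := expR (- (X (s + h) w - X s w)).

Lemma exp_decrement_bounds w : A w -> 0 <= exp_decrement w <= expR K.
Proof.
move=> Aw; rewrite /exp_decrement expR_ge0/= ler_expR opprB.
have := AK _ Aw; have := state_ge0 _ w sh0; lra.
Qed.

Lemma measurable_exp_decrement : measurable_fun setT exp_decrement.
Proof.
apply: measurableT_comp => //; apply: measurableT_comp => //.
by apply: measurable_funB; exact: measurable_state.
Qed.

Lemma integrable_exp_decrement_poly (p : {poly R}) :
  (P x).-integrable A (EFin \o (fun w => p.[exp_decrement w])).
Proof.
have H k : (P x).-integrable A (EFin \o (fun w => exp_decrement w ^+ k)).
  apply: (bounded_integrable _ _ _ (expR K ^+ k) mA).
    by apply: measurable_funX; exact: measurable_exp_decrement.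
  move=> w Aw; have /andP[z0 zK] := exp_decrement_bounds _ Aw.
  by rewrite ger0_norm ?exprn_ge0// lerXn2r ?nnegrE ?expR_ge0.
have := integrable_lincomb (P x) A mA (fun k => p`_k) _ H (size p).
by congr integrable; apply/funext => w /=; rewrite horner_coef.
Qed.

(** Z^k is e^(k X_s), known at time s, times e^(-k X_(s+h)), whose conditional mean is e^(-X_s
    v_h(k)). The first factor is pulled out as a weight. *)
Lemma exp_decrement_moment (k : nat) :
  \int[P x]_(w in A) exp_decrement w ^+ k =
  \int[P x]_(w in A) expR (- (X s w * (v h k%:R - k%:R))).
Proof.
have k0 := ler0n R k.
pose f w := expR (- (k%:R * X (s + h) w)).
pose g w := expR (- (X s w * v h k%:R)).
(* The weight e^(k X_s) scaled by e^(-kK), so as to lie in [0, 1]; on A the minimum is attained by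
   the exponential. *)
pose U w := Num.min 1 (expR (k%:R * (X s w - K))).
have v0 := cumulant_nat_ge0 _ k h0.
have mf : measurable_fun setT f.
  by rewrite /f; under eq_fun do rewrite -mulNr; exact: mE.
have mg : measurable_fun setT g.
  by rewrite /g; under eq_fun do rewrite mulrC -mulNr; exact: mE.
have mU0 : measurable_fun setT (fun y : R => Num.min 1 (expR (k%:R * (y - K)))).
  apply: measurable_minr => //; apply: measurableT_comp => //.
  by apply: measurable_funM => //; apply: measurable_funB.
have mU : measurable_fun setT U by exact: (measurable_process_comp mp s _ s0 mU0).
have fg : \int[P x]_(w in A) (U w * f w) = \int[P x]_(w in A) (U w * g w).
  apply: (eq_Rintegral_weighted (P x) (past X s) A f g U) => //.
  - by move=> w _; rewrite ger0_norm ?expR_ge0// expRN_le1// mulr_ge0// state_ge0.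
  - by move=> w _; rewrite ger0_norm ?expR_ge0// expRN_le1// mulr_ge0// state_ge0.
  - by move=> w _; rewrite le_min ler01 expR_ge0/= ge_min lexx.
  - move=> c; apply: pastI => //.
    rewrite (_ : mkset _ = X s @^-1`
        [set y : R | c <= Num.min 1 (expR (k%:R * (y - K)))])//.
    apply: past_preimage; first by rewrite s0 lexx.
    have := mU0 measurableT _ (measurable_itv `[c, +oo[); rewrite setTI.
    by congr measurable; apply/seteqP; split => y /=; rewrite in_itv/= andbT.
  - move=> B pB.
    apply: (markov_integral mp x s h B (fun y => expR (- (k%:R * y)))
      (fun y => expR (- (y * v h k%:R)))) => //.
    + by apply: measurableT_comp => //; apply: measurableT_comp.
    + apply: measurableT_comp => //; apply: measurableT_comp => //.
      exact: measurable_funM.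
    + by move=> y y0; rewrite expR_ge0/= expRN_le1// mulr_ge0.
    + by move=> y y0; exact: Rintegral_laplace.
have UE w : A w -> U w = expR (k%:R * X s w) * expR (- (k%:R * K)).
  move=> Aw; rewrite /U min_r -?expRD ?mulrBr//.
  by rewrite -expR0 ler_expR -mulrBr mulr_ge0_le0// subr_le0 AK.
have iU (q : T -> R) : measurable_fun setT q -> (forall w, A w -> 0 <= q w <= 1) ->
    (P x).-integrable A (EFin \o (fun w => U w * q w)).
  move=> mq q1; apply: (bounded_integrable _ _ _ 1 mA); first exact: measurable_funM.
  move=> w Aw; have /andP[a b] := q1 _ Aw.
  have U01 : 0 <= U w <= 1 by rewrite /U le_min ler01 expR_ge0/= ge_min lexx.
  have /andP[u0 u1] := U01.
  by rewrite normrM !ger0_norm// mulr_ile1.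
transitivity (expR (k%:R * K) * \int[P x]_(w in A) (U w * f w)).
  rewrite -RintegralZl//; last first.
    by apply: iU => // w Aw; rewrite expR_ge0/= expRN_le1// mulr_ge0// state_ge0.
  apply: eq_Rintegral => w /set_mem Aw; rewrite UE// /f /exp_decrement.
  rewrite -expRM_natl -!expRD.
  by congr expR; ring.
rewrite fg -RintegralZl//; last first.
  by apply: iU => // w Aw; rewrite expR_ge0/= expRN_le1// mulr_ge0// state_ge0.
apply: eq_Rintegral => w /set_mem Aw; rewrite UE// /g -!expRD.
by congr expR; ring.
Qed.

Let integrable_tilt (k : nat) : (P x).-integrable A
  (EFin \o (fun w => expR (- (X s w * (v h k%:R - k%:R))))).
Proof.
have v0 := cumulant_nat_ge0 _ k h0.
apply: (bounded_integrable _ _ _ (expR (k%:R * K)) mA).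
  by under eq_fun do rewrite mulrC -mulNr; exact: mE.
move=> w Aw; rewrite ger0_norm ?expR_ge0// ler_expR.
have := AK _ Aw; have := state_ge0 _ w s0; have := ler0n R k; nra.
Qed.

Lemma exp_decrement_poly (p : {poly R}) :
  \int[P x]_(w in A) p.[exp_decrement w] =
  \int[P x]_(w in A)
    (\sum_(k < size p) p`_k * expR (- (X s w * (v h k%:R - k%:R)))).
Proof.
rewrite (Rintegral_lincomb (P x) A mA (fun k => p`_k)
  (fun k w => expR (- (X s w * (v h k%:R - k%:R)))))//.
have H k : (P x).-integrable A (EFin \o (fun w => exp_decrement w ^+ k)).
  by have := integrable_exp_decrement_poly 'X^k; under eq_fun do rewrite hornerXn.
under eq_Rintegral do rewrite horner_coef.
rewrite (Rintegral_lincomb (P x) A mA (fun k => p`_k)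
  (fun k w => exp_decrement w ^+ k))//.
by apply: eq_bigr => k _; rewrite exp_decrement_moment.
Qed.

Lemma integrable_tilt_sum (p : {poly R}) : (P x).-integrable A (EFin \o (fun w =>
  \sum_(k < size p) p`_k * expR (- (X s w * (v h k%:R - k%:R))))).
Proof.
exact: (integrable_lincomb (P x) A mA (fun k => p`_k)
  (fun k w => expR (- (X s w * (v h k%:R - k%:R)))) integrable_tilt).
Qed.

Lemma integrable_state_window : (P x).-integrable A (EFin \o X s).
Proof.
apply: (bounded_integrable _ _ _ K mA); first exact: measurable_state.
by move=> w Aw; rewrite ger0_norm ?state_ge0// AK.
Qed.

Lemma Rintegral_state_ge0 : 0 <= \int[P x]_(w in A) X s w.
Proof. by apply: Rintegral_ge0 => w _; exact: state_ge0. Qed.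

End Window.

(** The threshold [h0] is independent of x, s and A, so a single mesh size serves all steps of the
    grid. *)
Lemma exp_decrement_poly_expansion (p : {poly R}) (K e : R) :
  p.[1] = 0 -> 0 <= K -> 0 < e ->
  exists2 h0, 0 < h0 & forall x s h A, 0 <= x -> 0 <= s -> 0 < h < h0 ->
    past X s A -> (forall w, A w -> X s w <= K) ->
    `|\int[P x]_(w in A) p.[exp_decrement s h w] - h * L p * \int[P x]_(w in A) X s w|
      <= e * h * \int[P x]_(w in A) X s w.
Proof.
move=> p1 K0 e0; have [C C0 hC] := small_time_expansion _ _ p1 K0.
(* Below this threshold the error C h^2 is at most e h. *)
exists (Num.min 1 (e / (C + 1))); first by rewrite lt_min ltr01 divr_gt0//; lra.
move=> x s h A x0 s0 /andP[h0]; rewrite lt_min => /andP[h1].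
rewrite ltr_pdivlMr; last lra.
move=> hC1 pA AK.
have mA := past_measurable mp _ _ pA.
have h0' := ltW h0.
rewrite (exp_decrement_poly x s h K A)// -!RintegralZl//;
  [|exact: (integrable_state_window x s K A)..].
have i1 := integrable_tilt_sum x s h K A s0 h0' pA AK p.
have i2 : (P x).-integrable A (EFin \o (fun w => h * L p * X s w)).
  by apply: integrable_scale => //; exact: (integrable_state_window x s K A).
rewrite -RintegralB//.
have iB := integrableB mA i1 i2.
apply: le_trans (le_normr_Rintegral mA iB) _.
apply: le_Rintegral => //.
- exact: integrable_norm.
- by apply: integrable_scale => //; exact: (integrable_state_window x s K A).
move=> w Aw; rewrite (mulrAC h).
have hh : 0 <= h <= 1 by lra.
have hX : 0 <= X s w <= K by rewrite state_ge0// AK.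
apply: le_trans (hC _ _ hh hX) _; apply: ler_wpM2r; first exact: state_ge0.
rewrite expr2 mulrA; apply: ler_wpM2r => //; nra.
Qed.

Lemma exp_decrement_poly_bound (p : {poly R}) : p.[1] = 0 ->
  exists2 C, 0 <= C & forall x s h A, 0 <= x -> 0 <= s -> 0 < h <= 1 ->
    past X s A -> (forall w, A w -> X s w <= h^-1) ->
    \int[P x]_(w in A) p.[exp_decrement s h w] <= C * h * \int[P x]_(w in A) X s w.
Proof.
move=> p1; have [C C0 hC] := small_time_bound _ p1.
exists C => // x s h A x0 s0 /andP[h0 h1] pA AK.
have mA := past_measurable mp _ _ pA.
have h0' := ltW h0.
rewrite (exp_decrement_poly x s h h^-1 A)// -RintegralZl//; last first.
  exact: (integrable_state_window x s h^-1 A).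
apply: le_Rintegral => //.
- exact: (integrable_tilt_sum x s h h^-1).
- by apply: integrable_scale => //; exact: (integrable_state_window x s h^-1 A).
move=> w Aw; rewrite -mulrA; apply: hC; first lra.
  exact: state_ge0.
by rewrite -ler_pdivlMl// mulr1 AK.
Qed.

End SmallTime.

Arguments exp_decrement {R d T} X s h w.

(** * The generator of near-indicators against the Lévy tail *)

Section GeneratorBounds.
Context {R : realType} {alpha beta : R}
  { pi : {sigma_finite_measure set R -> \bar R} }.
Hypothesis bp : branching_parameters alpha beta pi.
Notation L := (pgenerator alpha beta pi).
Notation axis := (`]0, +oo[%classic : set R).
Notation levy_tail r := (fine (pi `]r, +oo[%classic)).

Lemma measurable_horner_expRN (D : set R) (p : {poly R}) :
  measurable_fun D (fun th : R => p.[expR (- th)]).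
Proof.
under eq_fun do rewrite horner_coef.
apply: measurable_sum => k; apply: measurable_funM => //; apply: measurable_funX.
by apply: measurableT_comp => //; exact: oppr_measurable.
Qed.

Lemma horner_sqr_factor (q : {poly R}) (z : R) :
  ((1 - 'X) ^+ 2 * q).[z] = (1 - z) ^+ 2 * q.[z].
Proof. by rewrite !hornerE. Qed.

Lemma expRN_itv01 (th : R) : 0 <= th -> 0 <= expR (- th) <= 1.
Proof. by move=> th0; rewrite expR_ge0 expRN_le1. Qed.

Lemma integrable_horner_expRN (q : {poly R}) (C : R) :
  (forall z, 0 <= z <= 1 -> `|q.[z]| <= C) ->
  pi.-integrable axis (EFin \o (fun th : R => ((1 - 'X) ^+ 2 * q).[expR (- th)])).
Proof.
move=> qC; apply: (integrable_levy bp _ C); first exact: measurable_horner_expRN.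
move=> th th0; rewrite horner_sqr_factor normrM [X in X * _]ger0_norm ?sqr_ge0// mulrC.
apply: ler_pM => //; first exact: sqr_ge0.
  by apply: qC; apply: expRN_itv01; exact: ltW.
by apply: sqr_1BexpRN_le; exact: ltW.
Qed.

Lemma integrable_indic_tail (r : R) : 0 < r ->
  pi.-integrable axis (EFin \o (\1_(`]r, +oo[%classic) : R -> R)).
Proof.
move=> r0; apply/integrableP; split; first by apply/measurable_EFinP.
under eq_integral do rewrite /= ger0_norm//.
rewrite integral_indic//; apply: le_lt_trans (levy_tail_fin bp _ r0).
by apply: le_measure; rewrite ?inE//; exact: measurableI.
Qed.

Lemma Rintegral_indic_tail (r : R) : 0 < r ->
  \int[pi]_(th in axis) \1_(`]r, +oo[%classic) th = levy_tail r.
Proof.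
move=> r0; rewrite /Rintegral integral_indic//; congr (fine (pi _)).
by apply/setIidl; apply: subset_itvr; rewrite bnd_simp ltW.
Qed.

(** For th > r the integrand is at most 1. For th <= r it is at most e (1 - e^-th)^2 <= e min(th,
    th^2), of integral at most e times [levy_mass]. The beta term costs 2 beta q(1) <= 2 beta e. *)
Lemma pgenerator_le (q : {poly R}) (r e : R) : 0 < r -> 0 <= e ->
  (forall z, 0 <= z <= 1 -> 0 <= q.[z] <= 1) ->
  (forall z, expR (- r) <= z <= 1 -> q.[z] <= e) ->
  L ((1 - 'X) ^+ 2 * q) <= levy_tail r + e * (2 * beta + levy_mass pi).
Proof.
move=> r0 e0 q01 qe; rewrite (pgeneratorE bp) mulrDr addrCA.
have b0 := beta_ge0 bp; apply: lerD.
  rewrite mulrC; apply: ler_wpM2r; first by rewrite mulr_ge0.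
  by apply: qe; rewrite lexx expRN_le1// ltW.
rewrite -Rintegral_indic_tail// /levy_mass -RintegralZl//;
  last exact: (integrable_min_sqr bp).
rewrite -RintegralD//; [|exact: integrable_indic_tail|]; last first.
  by apply: integrable_scale => //; exact: (integrable_min_sqr bp).
apply: le_Rintegral => //.
- apply: (integrable_horner_expRN _ 1) => z z01.
  by have /andP[a b] := q01 _ z01; rewrite ger0_norm.
- have iM := integrable_scale pi axis (measurable_itv _) e _ (integrable_min_sqr bp).
  exact: (integrableD (measurable_itv _) (integrable_indic_tail _ r0) iM).
move=> th /axis_gt0 th0; rewrite horner_sqr_factor.
have /andP[z0 z1] := expRN_itv01 _ (ltW th0).
have s1 := sqr_1BexpRN_le _ (ltW th0).
have m0 := min_sqr_ge0 _ (ltW th0).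
have /andP[q0 q1] : 0 <= q.[expR (- th)] <= 1 by apply: q01; rewrite z0.
have s0 : 0 <= (1 - expR (- th)) ^+ 2 by exact: sqr_ge0.
rewrite indicE; have [rth|thr] := ltP r th.
  rewrite mem_set/= ?in_itv/= ?rth//.
  have : (1 - expR (- th)) ^+ 2 <= 1 by rewrite expr_le1//; lra.
  nra.
rewrite memNset; last by rewrite /= in_itv/= andbT; apply/negP; rewrite -leNgt.
have : q.[expR (- th)] <= e by apply: qe; rewrite z1 ler_expR lerN2 thr.
rewrite add0r mulrC => qe'; apply: ler_pM => //.
Qed.

(** Subtracting e makes the polynomial nonpositive wherever q <= e, as a minorant of an indicator
    must be; the price is e (2 beta + [levy_mass]). *)
Lemma pgenerator_ge (q : {poly R}) (r e : R) : 0 < r -> 0 <= e <= 1 ->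
  (forall z, 0 <= z <= 1 -> 0 <= q.[z] <= 1) ->
  (forall z, 0 <= z <= expR (- r) -> 1 - e <= q.[z]) ->
  (1 - e) * (1 - expR (- r)) ^+ 2 * levy_tail r - e * (2 * beta + levy_mass pi)
    <= L ((1 - 'X) ^+ 2 * (q - e%:P)).
Proof.
move=> r0 /andP[e0 e1] q01 qe; rewrite (pgeneratorE bp) mulrDr opprD addrA addrAC addrC.
have b0 := beta_ge0 bp; apply: lerD.
  rewrite hornerD hornerN hornerC -mulNr mulrC.
  apply: ler_wpM2l; first by rewrite mulr_ge0.
  by have /andP[] := q01 1 ltac:(by rewrite ler01 lexx); lra.
set c := (1 - e) * _.
have iI := integrable_scale pi axis (measurable_itv _) c _ (integrable_indic_tail _ r0).
have iM := integrable_scale pi axis (measurable_itv _) e _ (integrable_min_sqr bp).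
rewrite -Rintegral_indic_tail// /levy_mass -[c * _]RintegralZl//;
  last exact: integrable_indic_tail.
rewrite -[e * _]RintegralZl//; last exact: (integrable_min_sqr bp).
rewrite -RintegralB//.
apply: le_Rintegral => //.
- exact: (integrableB (measurable_itv _) iI iM).
- apply: (integrable_horner_expRN _ 1) => z z01.
  have /andP[a b] := q01 _ z01; rewrite hornerD hornerN hornerC ler_norml.
  by apply/andP; split; lra.
move=> th /axis_gt0 th0; rewrite horner_sqr_factor hornerD hornerN hornerC.
have /andP[z0 z1] := expRN_itv01 _ (ltW th0).
have s1 := sqr_1BexpRN_le _ (ltW th0).
have /andP[q0 q1] : 0 <= q.[expR (- th)] <= 1 by apply: q01; rewrite z0.
have s0 : 0 <= (1 - expR (- th)) ^+ 2 by exact: sqr_ge0.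
have s2 : e * (1 - expR (- th)) ^+ 2 <= e * Num.min th (th ^+ 2) by exact: ler_wpM2l.
rewrite mulrBr [_ * e]mulrC; apply: lerB => //.
rewrite indicE; have [rth|thr] := ltP r th; last first.
  rewrite memNset; last by rewrite /= in_itv/= andbT; apply/negP; rewrite -leNgt.
  by rewrite mulr0 mulr_ge0.
rewrite mem_set/= ?in_itv/= ?rth// mulr1 mulrC.
have rr : expR (- th) <= expR (- r) by rewrite ler_expR lerN2 ltW.
have r1 := expRN_le1 _ (ltW r0).
apply: ler_pM; rewrite ?sqr_ge0 ?subr_ge0//.
  by apply: qe; rewrite z0.
by apply: lerXn2r; rewrite ?nnegrE; lra.
Qed.

End GeneratorBounds.

(** * Probability of one large increment *)

Section LargeIncrement.
Context {R : realType} {alpha beta : R}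
  { pi : {sigma_finite_measure set R -> \bar R} }.
Hypothesis bp : branching_parameters alpha beta pi.
Notation Phi := (branching_mechanism alpha beta pi).
Notation L := (pgenerator alpha beta pi).
Notation levy_tail r := (fine (pi `]r, +oo[%classic)).
Context {v : R -> R -> R}.
Hypothesis vs : forall l, 0 <= l -> cumulant_solution Phi l (fun t => v t l).
Context {d : measure_display} {T : measurableType d}.
Context {X : R -> T -> R} {P : R -> probability T R}.
Hypothesis mp : markov_process X P.
Hypothesis lap : forall x t l : R, 0 <= x -> 0 <= t -> 0 <= l ->
  ('E_(P x)[(fun w => expR (- (l * X t w)))] = (expR (- (x * v t l)))%:E)%E.

Lemma measurable_increment (s h r : R) : 0 <= s -> 0 <= h ->
  measurable [set w | r < X (s + h) w - X s w].
Proof.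
move=> s0 h0; apply: (past_measurable mp (s + h)); apply: past_increment.
  by rewrite lexx addr_ge0.
by rewrite s0/= lerDl.
Qed.

Lemma Rintegral_indic_increment (x s h r : R) A : 0 <= s -> 0 <= h ->
  measurable A ->
  \int[P x]_(w in A) \1_[set w | r < X (s + h) w - X s w] w =
  fine (P x (A `&` [set w | r < X (s + h) w - X s w])).
Proof.
move=> s0 h0 mA; rewrite setIC /Rintegral integral_indic//.
exact: measurable_increment.
Qed.

Lemma integrable_indic_increment (x s h r : R) A : 0 <= s -> 0 <= h ->
  measurable A -> (P x).-integrable A
    (EFin \o (\1_[set w | r < X (s + h) w - X s w] : T -> R)).
Proof.
move=> s0 h0 mA; have mI := measurable_increment _ _ r s0 h0.
apply: (bounded_integrable _ _ _ 1 mA) => // w _.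
by rewrite indicE; case: (_ \in _); rewrite ?normr0 ?normr1.
Qed.

Lemma lt_exp_decrement (s h r : R) w :
  (r < X (s + h) w - X s w) = (exp_decrement X s h w < expR (- r)).
Proof. by rewrite /exp_decrement ltr_expR ltrN2. Qed.

(** (1 - Z)^2 q(Z) dominates (1 - e)(1 - e^-r)^2 times the indicator of an increment above r + de.
    The gap de is the room in which q falls from near 1 to near 0. *)
Lemma large_increment_le (r de K u : R) : 0 < r -> 0 < de -> 0 <= K ->
  levy_tail r < u ->
  exists2 h0, 0 < h0 & forall x s h A, 0 <= x -> 0 <= s -> 0 < h < h0 ->
    past X s A -> (forall w, A w -> X s w <= K) ->
    (1 - expR (- r)) ^+ 2 * fine (P x (A `&` [set w | r + de < X (s + h) w - X s w]))
      <= h * u * \int[P x]_(w in A) X s w.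
Proof.
move=> r0 de0 K0 ru.
have b0 := beta_ge0 bp; have m0 := levy_mass_ge0 (pi := pi).
have t0 : 0 <= levy_tail r by rewrite fine_ge0.
pose D := 2 * beta + levy_mass pi + 1 + u.
have D0 : 0 < D by rewrite /D; lra.
pose e := (u - levy_tail r) / D.
have e0 : 0 < e by rewrite divr_gt0//; lra.
have eD : e * D = u - levy_tail r by rewrite /e divfK// gt_eqF.
have e1 : e < 1 by rewrite ltr_pdivrMr// mul1r /D; lra.
have ab : 0 < expR (- (r + de)) < expR (- r).
  by rewrite expR_gt0 ltr_expR ltrN2 ltrDl.
have M1 : 1 <= expR K by rewrite -expR0 ler_expR.
have b1 := expRN_le1 _ (ltW r0).
have bM : expR (- r) <= expR K by lra.
have [q [q01 qa qb]] := indicator_poly _ _ _ _ ab (expR_gt0 K) bM e0.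
have q01' z : 0 <= z <= 1 -> 0 <= q.[z] <= 1.
  by move=> /andP[z0 z1]; apply: q01; rewrite z0 (le_trans z1).
have qb' z : expR (- r) <= z <= 1 -> q.[z] <= e.
  by move=> /andP[z0 z1]; apply: qb; rewrite z0 (le_trans z1).
have Lp := pgenerator_le bp q r e r0 (ltW e0) q01' qb'.
set p := _ * q in Lp.
have p1 : p.[1] = 0 by rewrite horner_sqr_factor subrr expr0n mul0r.
have [h0 h00 hh] := exp_decrement_poly_expansion bp vs mp lap p K e p1 K0 e0.
exists h0 => // x s h A x0 s0 hh0 pA AK.
have hp : 0 <= h by case/andP: hh0 => /ltW.
have mA := past_measurable mp _ _ pA.
have := hh x s h A x0 s0 hh0 pA AK => /ler_normlP[_ H].
have X0 := Rintegral_state_ge0 mp x s A s0.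
have ip := integrable_exp_decrement_poly mp x s h K A s0 hp pA AK p.
have key : (1 - e) * (1 - expR (- r)) ^+ 2 *
    fine (P x (A `&` [set w | r + de < X (s + h) w - X s w])) <=
    \int[P x]_(w in A) p.[exp_decrement X s h w].
  rewrite -Rintegral_indic_increment// -RintegralZl//;
    last exact: integrable_indic_increment.
  apply: le_Rintegral => //.
    by apply: integrable_scale => //; exact: integrable_indic_increment.
  move=> w Aw; have /andP[z0 zK] := exp_decrement_bounds mp s h K A s0 hp AK w Aw.
  rewrite horner_sqr_factor indicE.
  have /andP[qw0 qw1] : 0 <= q.[exp_decrement X s h w] <= 1 by apply: q01; rewrite z0.
  have [/set_mem/= Iw|_] := boolP (w \in _); last by rewrite mulr0 mulr_ge0// sqr_ge0.
  rewrite lt_exp_decrement in Iw; rewrite mulr1 mulrC; have /andP[a0 ab'] := ab.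
  apply: ler_pM; rewrite ?sqr_ge0//; first by rewrite subr_ge0 ltW.
    by apply: lerXn2r; rewrite ?nnegrE; clear -Iw ab' b1 z0; lra.
  by apply: qa; rewrite z0 ltW.
rewrite -(@ler_pM2l _ (1 - e)); last lra.
rewrite mulrA; apply: le_trans key _.
apply: (@le_trans _ _ (h * (L p + e) * \int[P x]_(w in A) X s w)).
  by rewrite mulrDr mulrDl; rewrite [h * e]mulrC; clear -H; lra.
rewrite (_ : (1 - e) * _ = h * ((1 - e) * u) * \int[P x]_(w in A) X s w); last by ring.
apply: ler_wpM2r => //; apply: ler_wpM2l => //.
by move: Lp eD; rewrite /D; clear; move: (L p) e (levy_mass _) => a e' b; lra.
Qed.

(** Now (1 - Z)^2 (q(Z) - e) lies below the indicator of an increment above r: it is at most 1 for Z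
    < e^-r and nonpositive for Z in [e^-r, e^K]. *)
Lemma large_increment_ge (r de K l : R) : 0 < r -> 0 < de -> 0 <= K -> 0 <= l ->
  l < (1 - expR (- r)) ^+ 2 * levy_tail (r + de) ->
  exists2 h0, 0 < h0 & forall x s h A, 0 <= x -> 0 <= s -> 0 < h < h0 ->
    past X s A -> (forall w, A w -> X s w <= K) ->
    h * l * \int[P x]_(w in A) X s w <=
    fine (P x (A `&` [set w | r < X (s + h) w - X s w])).
Proof.
move=> r0 de0 K0 l0 lr.
have mul_le1 (a b : R) : 0 <= a -> a <= 1 -> b <= 1 -> a * b <= 1 by nra.
have sqr_le1 (y z : R) : 0 <= y -> y < z -> z <= 1 -> (1 - y) ^+ 2 <= 1.
  by move=> *; rewrite expr_le1//; lra.
have arith (a m e kt kt' t l' : R) : (1 - e) * kt' - e * (2 * beta + m) <= a ->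
    e * (t + 2 * beta + m + 1) = kt - l' -> (1 - e) * kt <= (1 - e) * kt' ->
    e * kt <= e * t -> l' <= a - e.
  by lra.
have b0 := beta_ge0 bp; have m0 := levy_mass_ge0 (pi := pi).
have t0 : 0 <= levy_tail (r + de) by rewrite fine_ge0.
set t := levy_tail (r + de) in lr t0 *.
set k := (1 - expR (- r)) ^+ 2 in lr *.
have b1 := expRN_le1 _ (ltW r0).
have b2 := expR_ge0 (- r).
have k01 : 0 <= k <= 1 by rewrite /k sqr_ge0 expr_le1//; lra.
have /andP[k0 k1] := k01.
(* In e D, the term t pays for the factor 1 - e on k t, 2 beta + [levy_mass] for the generator
   bound, and 1 for the expansion error. *)
pose D := t + 2 * beta + levy_mass pi + 1.
have D0 : 0 < D by rewrite /D; lra.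
pose e := (k * t - l) / D.
have e0 : 0 < e by rewrite divr_gt0//; lra.
have eD : e * D = k * t - l by rewrite /e divfK// gt_eqF.
have kt : k * t <= t by rewrite ler_piMl.
have e1 : e < 1 by rewrite ltr_pdivrMr// mul1r /D; lra.
have ab : 0 < expR (- (r + de)) < expR (- r).
  by rewrite expR_gt0 ltr_expR ltrN2 ltrDl.
have M1 : 1 <= expR K by rewrite -expR0 ler_expR.
have bM : expR (- r) <= expR K by lra.
have [q [q01 qa qb]] := indicator_poly _ _ _ _ ab (expR_gt0 K) bM e0.
have q01' z : 0 <= z <= 1 -> 0 <= q.[z] <= 1.
  by move=> /andP[z0 z1]; apply: q01; rewrite z0 (le_trans z1).
have rde0 : 0 < r + de by lra.
have e01 : 0 <= e <= 1 by rewrite !ltW.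
have Lp := pgenerator_ge bp q (r + de) e rde0 e01 q01' qa.
set p := _ * (q - _) in Lp.
have p1 : p.[1] = 0 by rewrite horner_sqr_factor subrr expr0n mul0r.
have [h0 h00 hh] := exp_decrement_poly_expansion bp vs mp lap p K e p1 K0 e0.
exists h0 => // x s h A x0 s0 hh0 pA AK.
have hp : 0 <= h by case/andP: hh0 => /ltW.
have mA := past_measurable mp _ _ pA.
have := hh x s h A x0 s0 hh0 pA AK => /ler_normlP[H _].
have X0 := Rintegral_state_ge0 mp x s A s0.
have ip := integrable_exp_decrement_poly mp x s h K A s0 hp pA AK p.
have key : \int[P x]_(w in A) p.[exp_decrement X s h w] <=
    fine (P x (A `&` [set w | r < X (s + h) w - X s w])).
  rewrite -Rintegral_indic_increment//.
  apply: le_Rintegral => //; first exact: integrable_indic_increment.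
  move=> w Aw; have /andP[z0 zK] := exp_decrement_bounds mp s h K A s0 hp AK w Aw.
  rewrite horner_sqr_factor indicE hornerD hornerN hornerC.
  have /andP[qw0 qw1] : 0 <= q.[exp_decrement X s h w] <= 1 by apply: q01; rewrite z0.
  have [/set_mem/= Iw|/negP Iw] := boolP (w \in _).
    rewrite lt_exp_decrement in Iw; apply: mul_le1; first exact: sqr_ge0; last first.
      by rewrite lerBlDr (le_trans qw1)// lerDl ltW.
    exact: (sqr_le1 _ _ z0 Iw b1).
  apply: mulr_ge0_le0; first exact: sqr_ge0.
  rewrite subr_le0; apply: qb; rewrite zK andbT leNgt -lt_exp_decrement.
  by apply/negP => hI; apply: Iw; rewrite inE.
apply: le_trans key.
apply: (@le_trans _ _ (h * (L p - e) * \int[P x]_(w in A) X s w)); last first.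
  by rewrite mulrBr mulrBl [h * e]mulrC lerBlDr -lerBlDl -opprB.
apply: ler_wpM2r => //; apply: ler_wpM2l => //.
have kk : k <= (1 - expR (- (r + de))) ^+ 2.
  case/andP: ab => _ ab'; apply: lerXn2r; rewrite ?nnegrE ?subr_ge0//.
    by rewrite (le_trans (ltW ab')).
  by rewrite lerD2l lerN2 ltW.
have e1' : 0 <= 1 - e by rewrite subr_ge0 ltW.
apply: (arith _ _ _ _ _ _ _ _ eD); last by apply: ler_wpM2l => //; exact: ltW.
  by move: Lp; rewrite -mulrA; apply.
by apply: ler_wpM2l => //; apply: ler_wpM2r.
Qed.

(** Already (1 - Z)^2 is at least (1 - e^-r)^2 when the increment exceeds r. The order h X_s is kept
    for all states up to 1/h, at the price of an unspecified constant. *)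
Lemma large_increment_bound (r : R) : 0 < r ->
  exists2 C, 0 <= C & forall x s h A, 0 <= x -> 0 <= s -> 0 < h <= 1 ->
    past X s A -> (forall w, A w -> X s w <= h^-1) ->
    fine (P x (A `&` [set w | r < X (s + h) w - X s w]))
      <= C * h * \int[P x]_(w in A) X s w.
Proof.
move=> r0; pose p : {poly R} := (1 - 'X) ^+ 2 * 1.
have p1 : p.[1] = 0 by rewrite horner_sqr_factor subrr expr0n mul0r.
have [C C0 hC] := exp_decrement_poly_bound bp vs mp lap p p1.
have b1 : expR (- r) < 1 by rewrite -expR0 ltr_expR; lra.
have k0 : 0 < (1 - expR (- r)) ^+ 2 by rewrite exprn_gt0//; lra.
exists (C / (1 - expR (- r)) ^+ 2); first by rewrite divr_ge0// ltW.
move=> x s h A x0 s0 h01 pA AK.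
have hp : 0 <= h by case/andP: h01 => /ltW.
have mA := past_measurable mp _ _ pA.
rewrite (_ : _ * h * _ =
  (C * h * \int[P x]_(w in A) X s w) / (1 - expR (- r)) ^+ 2); last by ring.
rewrite ler_pdivlMr// mulrC; apply: le_trans (hC x s h A x0 s0 h01 pA AK).
rewrite -Rintegral_indic_increment// -RintegralZl//;
    last exact: integrable_indic_increment.
apply: le_Rintegral => //.
- by apply: integrable_scale => //; exact: integrable_indic_increment.
- exact: (integrable_exp_decrement_poly mp x s h h^-1 A).
move=> w Aw; rewrite horner_sqr_factor hornerC mulr1 indicE.
have [/set_mem/= Iw|_] := boolP (w \in _); last by rewrite mulr0 sqr_ge0.
rewrite lt_exp_decrement in Iw; rewrite mulr1.
by apply: lerXn2r; rewrite ?nnegrE; lra.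
Qed.

End LargeIncrement.

(** * First moments of the state and uniform truncation *)

Section Mean.
Context {R : realType} {alpha beta : R}
  { pi : {sigma_finite_measure set R -> \bar R} }.
Hypothesis bp : branching_parameters alpha beta pi.
Notation Phi := (branching_mechanism alpha beta pi).
Context {v : R -> R -> R}.
Hypothesis vs : forall l, 0 <= l -> cumulant_solution Phi l (fun t => v t l).
Context {d : measure_display} {T : measurableType d}.
Context {X : R -> T -> R} {P : R -> probability T R}.
Hypothesis mp : markov_process X P.
Hypothesis lap : forall x t l : R, 0 <= x -> 0 <= t -> 0 <= l ->
  ('E_(P x)[(fun w => expR (- (l * X t w)))] = (expR (- (x * v t l)))%:E)%E.

(** An approximation of y, bounded by 1/l, whose mean is explicit from the Laplace transform. *)
Definition soft_cap (l y : R) : R := (1 - expR (- (l * y))) / l.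

Lemma soft_cap_bounds (l y : R) : 0 < l -> 0 <= y ->
  [/\ 0 <= soft_cap l y, soft_cap l y <= y, soft_cap l y <= l^-1 &
      y - soft_cap l y <= l * y ^+ 2].
Proof.
move=> l0 y0; have ly : 0 <= l * y by rewrite mulr_ge0// ltW.
have e1 := expRN_le1 _ ly; have e2 := expRN_sub1D_ge0 (l * y).
have e0 := expR_ge0 (- (l * y)).
have := expRN_sub1D_le _ ly; rewrite le_min => /andP[_ e3].
split; rewrite /soft_cap.
- by apply: divr_ge0; lra.
- by rewrite ler_pdivrMr// [y * l]mulrC; lra.
- by rewrite ler_pdivrMr// mulVf ?gt_eqF//; lra.
- rewrite -(ler_pM2r l0) mulrBl divfK ?gt_eqF//.
  by move: e3; rewrite exprMn expr2; lra.
Qed.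

Lemma measurable_soft_cap (l s : R) : 0 <= s ->
  measurable_fun setT (fun w => soft_cap l (X s w)).
Proof.
move=> s0; apply: measurable_funM => //; apply: measurable_funB => //.
apply: measurableT_comp => //; apply: measurableT_comp => //.
by apply: measurable_funM => //; exact: (measurable_state mp).
Qed.

Lemma integrable_soft_cap (x s l : R) : 0 <= s -> 0 < l ->
  (P x).-integrable setT (EFin \o (fun w => soft_cap l (X s w))).
Proof.
move=> s0 l0; apply: (bounded_integrable _ _ _ l^-1 measurableT).
  exact: measurable_soft_cap.
move=> w _; have [a _ b _] := soft_cap_bounds _ _ l0 (state_ge0 mp s w s0).
by rewrite ger0_norm.
Qed.

Lemma Rintegral_soft_cap (x s l : R) : 0 <= x -> 0 <= s -> 0 < l ->
  \int[P x]_w soft_cap l (X s w) = (1 - expR (- (x * v s l))) / l.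
Proof.
move=> x0 s0 l0; have l0' := ltW l0.
have iE : (P x).-integrable setT (EFin \o (fun w => expR (- (l * X s w)))).
  apply: (bounded_integrable _ _ _ 1 measurableT).
    apply: measurableT_comp => //; apply: measurableT_comp => //.
    by apply: measurable_funM => //; exact: (measurable_state mp).
  move=> w _; rewrite ger0_norm ?expR_ge0// expRN_le1// mulr_ge0//.
  exact: (state_ge0 mp).
have i1 : (P x).-integrable setT (EFin \o cst (1 : R)).
  exact: finite_measure_integrable_cst.
rewrite /soft_cap RintegralZr//; last exact: (integrableB measurableT i1 iE).
rewrite RintegralB// (Rintegral_laplace lap)// Rintegral_cst//.
by rewrite mul1r (congr1 fine (probability_setT (P x))).
Qed.

Lemma soft_cap_mean_le (x s l : R) : 0 <= x -> 0 <= s -> 0 < l ->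
  \int[P x]_w soft_cap l (X s w) <= x * expR (- (alpha * s)).
Proof.
move=> x0 s0 l0; rewrite Rintegral_soft_cap// ler_pdivrMr//.
have vle := cumulant_le bp (vs _ (ltW l0)) _ s0.
have := expRN_sub1D_ge0 (x * v s l).
have : x * v s l <= x * (l * expR (- (alpha * s))) by exact: ler_wpM2l.
lra.
Qed.

(** Fatou's lemma for the soft caps with l = 1/(n+1). *)
Lemma state_mean_le (x s : R) : 0 <= x -> 0 <= s ->
  (\int[P x]_w (X s w)%:E <= (x * expR (- (alpha * s)))%:E)%E.
Proof.
move=> x0 s0; pose f (n : nat) w := (soft_cap n.+1%:R^-1 (X s w))%:E.
have n0 n : 0 < n.+1%:R^-1 :> R by rewrite invr_gt0.
have X0 w := state_ge0 mp s w s0.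
have fc w : limn_einf (f ^~ w) = (X s w)%:E.
  have /cvg_limn_einf_sup[] // : f n w @[n --> \oo] --> (X s w)%:E.
  apply: cvg_EFin; first exact: nearW.
  apply: (@squeeze_cvgr _ _ _ _ (fun n : nat => X s w - n.+1%:R^-1 * X s w ^+ 2)
    (fun=> X s w)).
  - apply: nearW => n /=; have [_ a _ b] := soft_cap_bounds _ _ (n0 n) (X0 w).
    by rewrite a andbT lerBlDr -lerBlDl.
  - rewrite -[X in _ --> X]subr0; apply: cvgB; first exact: cvg_cst.
    rewrite -(mul0r (X s w ^+ 2)); apply: cvgM; last exact: cvg_cst.
    exact: cvg_harmonic.
  - exact: cvg_cst.
under eq_integral do rewrite -fc.
apply: le_trans (fatou (P x) measurableT _ _) _.
- by move=> n; apply/measurable_EFinP; exact: measurable_soft_cap.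
- by move=> n w _; rewrite lee_fin; have [] := soft_cap_bounds _ _ (n0 n) (X0 w).
rewrite limn_einf_lim; apply: lime_le; first exact: is_cvg_einfs.
apply: nearW => n; apply: (@le_trans _ _ (\int[P x]_w f n w)%E).
  by apply: ereal_inf_lbound; exists n => /=.
rewrite -[leLHS]fineK; last first.
  exact: (integrable_fin_num measurableT (integrable_soft_cap _ _ _ s0 (n0 n))).
by rewrite lee_fin; exact: soft_cap_mean_le.
Qed.

Lemma integrable_state (x s : R) : 0 <= x -> 0 <= s ->
  (P x).-integrable setT (EFin \o X s).
Proof.
move=> x0 s0; apply/integrableP; split.
  by apply/measurable_EFinP; exact: (measurable_state mp).
apply: le_lt_trans (ltry (x * expR (- (alpha * s)))).
apply: le_trans (state_mean_le x s x0 s0).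
rewrite le_eqVlt; apply/orP; left; apply/eqP; apply: eq_integral => w _ /=.
by rewrite ger0_norm// (state_ge0 mp).
Qed.

Lemma state_Rmean_le (x s : R) : 0 <= x -> 0 <= s ->
  \int[P x]_w X s w <= x * expR (- (alpha * s)).
Proof.
move=> x0 s0; rewrite -lee_fin fineK; last first.
  exact: (integrable_fin_num measurableT (integrable_state _ _ x0 s0)).
exact: state_mean_le.
Qed.

Lemma expR_absM_le (s t : R) : 0 <= s <= t ->
  expR (- (alpha * s)) <= expR (`|alpha| * t) /\
  expR (`|alpha| * s) <= expR (`|alpha| * t).
Proof.
move=> /andP[s0 st]; have h : `|alpha| * s <= `|alpha| * t by exact: ler_wpM2l.
split; rewrite ler_expR//; apply: le_trans h.
by rewrite -mulNr; apply: ler_wpM2r => //; rewrite -normrN ler_norm.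
Qed.

(** On {X_s > K} the cap is at most 1/l <= X_s/(lK), so the truncated mean is at least E[cap] -
    E[X_s]/(lK). First l is fixed to bring E[cap] near x e^(-alpha s) for all s <= t, then K. *)
Lemma state_window_mean_ge (x t e : R) : 0 <= x -> 0 <= t -> 0 < e ->
  exists2 K, 0 < K & forall s, 0 <= s <= t ->
    x * expR (- (alpha * s)) - e <= \int[P x]_(w in [set w | X s w <= K]) X s w.
Proof.
move=> x0 t0 e0; set B := expR (`|alpha| * t).
have B0 : 0 < B by exact: expR_gt0.
have xtB : 0 <= x * t * B by rewrite !mulr_ge0// ltW.
have xB : 0 <= x * B by rewrite mulr_ge0// ltW.
have arith q : 0 <= q -> e / (4 * (q + 1)) * q <= e / 4.
  move=> q0; rewrite invfM mulrA -mulrA ler_piMr//; first lra.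
  by rewrite mulrC ler_pdivrMr; lra.
pose e1 := e / (4 * (x * t * B + 1)).
have e10 : 0 < e1 by rewrite divr_gt0//; lra.
have he1 : x * t * B * e1 <= e / 4.
  by rewrite mulrC; exact: arith.
have [d0 d00 hd] := nonlinear_part_small bp _ e10.
(* The first bound keeps the cumulant in the range where its nonlinear part is at most e1 times it;
   the second controls the quadratic error in 1 - e^(-x v). *)
pose l := Num.min (d0 / B) (e / (4 * ((x * B) ^+ 2 + 1))).
have q0 : 0 < (x * B) ^+ 2 + 1 by have := sqr_ge0 (x * B); lra.
have l0 : 0 < l by rewrite lt_min !divr_gt0// mulr_gt0.
have lB : l * B <= d0 by rewrite -ler_pdivlMr// ge_min lexx.
have hl : l * (x * B) ^+ 2 <= e / 4.
  apply: (@le_trans _ _ (e / (4 * ((x * B) ^+ 2 + 1)) * (x * B) ^+ 2)).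
    by apply: ler_wpM2r; [exact: sqr_ge0|rewrite ge_min lexx orbT].
  by apply: arith; exact: sqr_ge0.
pose K := 4 * (x * B + 1) / (l * e).
have K0 : 0 < K by rewrite divr_gt0//; [lra|exact: mulr_gt0].
have lK : 0 < l * K by exact: mulr_gt0.
have hK : (x * B) / (l * K) <= e / 4.
  rewrite (_ : l * K = 4 * (x * B + 1) / e); last first.
    by rewrite /K; field; apply/andP; split; rewrite gt_eqF.
  rewrite invf_div mulrA ler_pdivrMr; last lra.
  nra.
exists K => // s /andP[s0 st].
have X0 w := state_ge0 mp s w s0.
have [Bs Bs'] : expR (- (alpha * s)) <= B /\ expR (`|alpha| * s) <= B.
  by apply: expR_absM_le; rewrite s0.
have ld : l * expR (`|alpha| * s) <= d0.
  by apply: le_trans lB; apply: ler_wpM2l => //; exact: ltW.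
have vge := cumulant_ge bp (ltW l0) (vs _ (ltW l0)) s e1 d0 s0 (ltW e10) hd ld.
have vle := cumulant_le bp (vs _ (ltW l0)) _ s0.
have v0 := cumulant_ge0 (vs _ (ltW l0)) s0.
set E := expR (- (alpha * s)) in Bs vge vle *.
have E0 : 0 <= E by exact: expR_ge0.
have capge : x * E - e / 4 - e / 4 <= \int[P x]_w soft_cap l (X s w).
  rewrite Rintegral_soft_cap// ler_pdivlMr//.
  have u0 : 0 <= x * v s l by rewrite mulr_ge0.
  have := expRN_sub1D_le _ u0; rewrite le_min => /andP[_ h1].
  have h2 : x * v s l >= x * (l * (1 - e1 * s) * E) by exact: ler_wpM2l.
  have h3 : (x * v s l) ^+ 2 <= l * (e / 4).
    apply: (@le_trans _ _ ((x * (l * B)) ^+ 2)).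
      apply: lerXn2r; rewrite ?nnegrE ?mulr_ge0 ?(ltW l0) ?(ltW B0)//.
      apply: ler_wpM2l => //; apply: le_trans vle _; apply: ler_wpM2l => //.
      exact: ltW.
    rewrite mulrCA exprMn expr2 -mulrA; apply: ler_wpM2l => //; exact: ltW.
  have h4 : x * e1 * s * E <= e / 4.
    apply: le_trans he1; rewrite (_ : x * t * B * e1 = x * e1 * t * B); last by ring.
    have xe : 0 <= x * e1 by rewrite mulr_ge0// ltW.
    by apply: ler_pM => //; [exact: mulr_ge0|exact: ler_wpM2l].
  have h5 : l * (x * e1 * s * E) <= l * (e / 4) by apply: ler_wpM2l => //; exact: ltW.
  move: h1 h2 h3 h5; rewrite [x * (l * (1 - e1 * s) * E)](_ : _ =
    x * E * l - l * (x * e1 * s * E)); last by ring.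
  lra.
have iX := integrable_state x s x0 s0.
have mA : measurable [set w | X s w <= K].
  by apply: (past_measurable mp s); exact: past_state_le.
have iC := integrable_soft_cap x s l s0 l0.
have iK : (P x).-integrable setT (EFin \o (fun w => (l * K)^-1 * X s w)).
  exact: integrable_scale.
have key : \int[P x]_w (soft_cap l (X s w) - (l * K)^-1 * X s w) <=
    \int[P x]_(w in [set w | X s w <= K]) X s w.
  rewrite [leRHS]Rintegral_mkcond; apply: le_Rintegral => //.
  - exact: (integrableB measurableT iC iK).
  - rewrite -restrict_EFin; apply/integrable_restrict => //; rewrite setTI.
    by apply: integrableS iX.
  move=> w _; have [c1 c2 c3 _] := soft_cap_bounds _ _ l0 (X0 w).
  rewrite patchE; case: ifPn => [_|/negP wK].
    by rewrite lerBlDr (le_trans c2)// lerDl mulr_ge0// invr_ge0 ltW.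
  have {wK} wK : K < X s w by rewrite ltNge; apply/negP => h; apply: wK; rewrite inE.
  rewrite subr_le0; apply: le_trans c3 _; rewrite invfM -mulrA -[leLHS]mulr1.
  apply: ler_wpM2l; first by rewrite invr_ge0 ltW.
  by rewrite mulrC ler_pdivlMr// mul1r ltW.
apply: le_trans key; rewrite RintegralB// RintegralZl//.
have mean := state_Rmean_le x s x0 s0.
have : (l * K)^-1 * \int[P x]_w X s w <= e / 4.
  apply: le_trans hK; rewrite mulrC; apply: ler_wpM2r; first by rewrite invr_ge0 ltW.
  by apply: le_trans mean _; apply: ler_wpM2l.
move: capge e0; clear; move: (x * E) (\int[P x]_w _) (_ * \int[P x]_w _) => a b c; lra.
Qed.

Lemma Rintegral_state_split (x s : R) A : 0 <= x -> 0 <= s -> measurable A ->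
  \int[P x]_(w in A) X s w + \int[P x]_(w in ~` A) X s w <= x * expR (- (alpha * s)).
Proof.
move=> x0 s0 mA; rewrite -Rintegral_setU//.
- by rewrite setUv; exact: state_Rmean_le.
- exact: measurableC.
- by rewrite setUv; exact: integrable_state.
- by apply/disj_setPCl.
Qed.

End Mean.

(** * Real-valued probabilities *)

Section RealProbability.
Context {d : measure_display} {T : measurableType d} {R : realType}.
Variable P : probability T R.
Implicit Types A B : set T.

Lemma fine_probability_le1 A : measurable A -> 0 <= fine (P A) <= 1.
Proof.
move=> mA; rewrite fine_ge0//= -lee_fin fineK ?fin_num_measure//.
exact: probability_le1.
Qed.

Lemma le_fine_probability A B : measurable A -> measurable B -> A `<=` B ->
  fine (P A) <= fine (P B).
Proof.
by move=> mA mB AB; apply: fine_le; rewrite ?fin_num_measure// le_measure ?inE.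
Qed.

Lemma fine_probabilityU_le A B : measurable A -> measurable B ->
  fine (P (A `|` B)) <= fine (P A) + fine (P B).
Proof.
move=> mA mB; have mAB : measurable (A `|` B) by exact: measurableU.
rewrite -lee_fin EFinD !fineK ?fin_num_measure//.
exact: measureU2.
Qed.

Lemma fine_probabilityU A B : measurable A -> measurable B -> A `&` B = set0 ->
  fine (P (A `|` B)) = fine (P A) + fine (P B).
Proof. by move=> mA mB AB; rewrite measureU// fineD ?fin_num_measure. Qed.

End RealProbability.

(** * Riemann sums of e^(-alpha s) *)

Section Discount.
Context {R : realType}.
Implicit Types alpha t h : R.

Lemma discount_gt0 alpha t : 0 < t -> 0 < discount alpha t.
Proof.
move=> t0; rewrite /discount; case: eqVneq => // a0.
have [a_gt0|a_lt0] : 0 < alpha \/ alpha < 0 by case: (ltgtP alpha 0) a0; [right|left|].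
  by rewrite divr_gt0// subr_gt0 -expR0 ltr_expR oppr_lt0 mulr_gt0.
rewrite -mulrNN mulr_gt0// ?oppr_gt0 ?invr_lt0//.
by rewrite subr_lt0 -expR0 ltr_expR oppr_gt0 nmulr_rlt0.
Qed.

(** For alpha <> 0 the sum is geometric with ratio q = e^(-alpha h), so the only error is the
    replacement of 1 - q by alpha h. *)
Lemma discount_riemann alpha t n (h := t / n.+1%:R) : 0 < t ->
  `|h * (\sum_(i < n.+1) expR (- (alpha * (i%:R * h)))) - discount alpha t|
    <= t * expR (`|alpha| * t) ^+ 2 * `|alpha| * h.
Proof.
move=> t0; have h0 : 0 < h by rewrite divr_gt0.
have hn : n.+1%:R * h = t by rewrite /h mulrC divfK// pnatr_eq0.
rewrite /discount; case: eqVneq => [->|a0].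
  rewrite normr0 mulr0 mul0r (eq_bigr (fun=> 1)); last first.
    by move=> i _; rewrite mul0r oppr0 expR0.
  by rewrite sumr_const card_ord mulrC hn subrr normr0.
set S := \sum_(i < n.+1) _; set q := expR (- (alpha * h)).
have SE : S * (1 - q) = 1 - expR (- (alpha * t)).
  have -> : S = \sum_(i < n.+1) q ^+ i.
    apply: eq_bigr => i _; rewrite /q -expRM_natl; congr expR; ring.
  rewrite mulrC -[1 - q]opprB mulNr -subrX1 opprB; congr (1 - _).
  by rewrite /q -expRM_natl mulrN mulrCA hn.
have ih (i : 'I_n.+1) : 0 <= i%:R * h <= t.
  rewrite mulr_ge0 ?(ltW h0)//= -hn; apply: ler_wpM2r; first exact: ltW.
  by rewrite ler_nat ltnW.
have S0 : 0 <= S by apply: sumr_ge0 => i _; exact: expR_ge0.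
have St : h * S <= t * expR (`|alpha| * t).
  apply: (@le_trans _ _ (h * \sum_(i < n.+1) expR (`|alpha| * t))).
    apply: ler_wpM2l; first exact: ltW.
    by apply: ler_sum => i _; have [] := expR_absM_le (alpha := alpha) _ _ (ih i).
  rewrite sumr_const card_ord -mulr_natl mulrA [h * _]mulrC hn//.
rewrite -SE.
have -> : h * S - S * (1 - q) / alpha = S * (q - 1 - - (alpha * h)) / alpha.
  by field.
rewrite !normrM normfV ler_pdivrMr ?normr_gt0//.
have hq : `|- (alpha * h)| <= `|alpha| * t.
  rewrite normrN normrM (gtr0_norm h0); apply: ler_wpM2l => //.
  by rewrite -hn ler_peMl ?(ltW h0)// ler1n.
have := dist_expR1D_le _ _ hq; rewrite -/q => hq2.
rewrite (ger0_norm S0); apply: le_trans (ler_wpM2l S0 hq2) _.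
rewrite sqrrN exprMn -[alpha ^+ 2]real_normK ?num_real//.
set B := expR _ in St *; have B0 : 0 <= B by exact: expR_ge0.
rewrite (_ : S * _ = (h * S) * (B * `|alpha| ^+ 2 * h)); last by ring.
rewrite (_ : t * _ * _ * _ * _ = (t * B) * (B * `|alpha| ^+ 2 * h)); last by ring.
by apply: ler_wpM2r => //; rewrite !mulr_ge0 ?sqr_ge0// ltW.
Qed.

Lemma discount_cvg alpha t : 0 < t -> forall e, 0 < e -> \forall n \near \oo,
  `|t / n.+1%:R * (\sum_(i < n.+1) expR (- (alpha * (i%:R * (t / n.+1%:R)))))
     - discount alpha t| <= e.
Proof.
move=> t0 e e0; set D := t * expR (`|alpha| * t) ^+ 2 * `|alpha|.
have D0 : 0 <= D by rewrite !mulr_ge0 ?sqr_ge0 ?(ltW t0).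
have e1 : 0 < e / (D + 1) by rewrite divr_gt0//; lra.
apply: filterS (near_infty_step t _ e1) => n hn.
apply: le_trans (discount_riemann _ _ _ t0) _; rewrite -/D.
apply: (@le_trans _ _ (D * (e / (D + 1)))); first by apply: ler_wpM2l => //; exact: ltW.
rewrite mulrA ler_pdivrMr; nra.
Qed.

End Discount.

(** Arithmetic of [step_upper]: [p1I], [p2I], [p3] are probabilities for states up to K, from K to
    1/h, and above 1/h; [a1], [a2], [a3] are the means of the state there, [aC] its mean above K,
    and E bounds the full mean. *)
Lemma step_upper_arith {R : realType}
    {h C u eta k pI p1I p2I p3 pu pv a1 aC a2 a3 E : R} :
  0 < h -> 0 <= C -> 0 <= u -> 0 < eta -> 0 <= k <= 1 -> 0 <= a1 -> 0 <= aC ->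
  pI <= pv -> pv <= p1I + pu -> pu <= p2I + p3 ->
  k * p1I <= h * u * a1 -> p2I <= C * h * a2 -> p3 <= h * a3 ->
  a2 <= aC -> a3 <= aC -> a1 + aC <= E -> E - eta / (C + 1) <= a1 ->
  k * pI <= h * (u * E + eta).
Proof.
move=> h0 C0 u0 eta0 /andP[k0 k1] X1 XC PI PU PU2 B1 B2 B3 I2 I3 split win.
have aCe : aC <= eta / (C + 1) by lra.
have pI' : pI <= p1I + (p2I + p3) by lra.
have b2 : p2I + p3 <= h * (C + 1) * aC.
  rewrite (_ : h * (C + 1) * aC = C * h * aC + h * aC); last by ring.
  apply: lerD.
    by apply: le_trans B2 _; apply: ler_wpM2l => //; rewrite mulr_ge0// ltW.
  by apply: le_trans B3 _; apply: ler_wpM2l => //; exact: ltW.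
have b2' : p2I + p3 <= h * eta.
  apply: le_trans b2 _; rewrite -mulrA; apply: ler_wpM2l; first exact: ltW.
  by rewrite mulrC -ler_pdivlMr//; lra.
have b20 : k * (p2I + p3) <= h * eta.
  have he0 : 0 <= h * eta by rewrite mulr_ge0// ltW.
  apply: (@le_trans _ _ (k * (h * eta))); first exact: ler_wpM2l.
  by rewrite ler_piMl.
have b1 : k * p1I <= h * (u * E).
  apply: le_trans B1 _; rewrite -mulrA; apply: ler_wpM2l; first exact: ltW.
  by apply: ler_wpM2l => //; move: split XC; clear; lra.
have := ler_wpM2l k0 pI'; move: b1 b20; rewrite !mulrDr; lra.
Qed.

(** * Probability that some grid increment is large *)

Section GridHits.
Context {R : realType} {alpha beta : R}
  { pi : {sigma_finite_measure set R -> \bar R} }.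
Hypothesis bp : branching_parameters alpha beta pi.
Notation Phi := (branching_mechanism alpha beta pi).
Notation levy_tail r := (fine (pi `]r, +oo[%classic)).
Context {v : R -> R -> R}.
Hypothesis vs : forall l, 0 <= l -> cumulant_solution Phi l (fun t => v t l).
Context {d : measure_display} {T : measurableType d}.
Context {X : R -> T -> R} {P : R -> probability T R}.
Hypothesis mp : markov_process X P.
Hypothesis lap : forall x t l : R, 0 <= x -> 0 <= t -> 0 <= l ->
  ('E_(P x)[(fun w => expR (- (l * X t w)))] = (expR (- (x * v t l)))%:E)%E.

Definition hits (h r : R) (i : nat) : set T :=
  [set w | exists2 j, (j < i)%N & r < grid_increment (fun s => X s w) h j].

Lemma hitsS (h r : R) i : hits h r i.+1 =
  hits h r i `|` [set w | r < X (i%:R * h + h) w - X (i%:R * h) w].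
Proof.
apply/seteqP; split => w /=.
  by move=> [j]; rewrite ltnS leq_eqVlt => /predU1P[-> H|ji H]; [right|left; exists j].
by move=> [[j ji H]|H]; [exists j => //; exact: ltnW|exists i].
Qed.

Lemma hits0 (h r : R) : hits h r 0 = set0.
Proof. by apply/seteqP; split => w //= -[]. Qed.

Lemma past_hits (h r : R) i : 0 <= h -> past X (i%:R * h) (hits h r i).
Proof.
move=> h0; elim: i => [|i IH].
  by rewrite hits0 -setCT; apply: pastC; exact: pastT.
have ih0 : 0 <= i%:R * h by rewrite mulr_ge0.
have iS : i.+1%:R * h = i%:R * h + h by rewrite -natr1 mulrDl mul1r.
rewrite hitsS setUC -[_ `|` _]setCK setCU; apply: pastC; apply: pastI; apply: pastC.
  by apply: past_increment; rewrite iS ?lexx ?ih0/= ?lerDl ?addr_ge0.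
by apply: subset_past IH; rewrite iS lerDl.
Qed.

Lemma measurable_hits (h r : R) i : 0 <= h -> measurable (hits h r i).
Proof. by move=> h0; apply: (past_measurable mp); exact: past_hits. Qed.

Lemma measurable_grid_increment (h r : R) (i : nat) : 0 <= h ->
  measurable [set w | r < X (i%:R * h + h) w - X (i%:R * h) w].
Proof. by move=> h0; apply: (measurable_increment mp) => //; rewrite mulr_ge0. Qed.

Lemma subset_hits (h r : R) i j : (i <= j)%N -> hits h r i `<=` hits h r j.
Proof. by move=> ij w [k ki H]; exists k => //; exact: leq_trans ki ij. Qed.

Lemma subset_Rintegral_state (x s : R) A B : 0 <= x -> 0 <= s ->
  measurable A -> measurable B -> A `<=` B ->
  \int[P x]_(w in A) X s w <= \int[P x]_(w in B) X s w.
Proof.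
move=> x0 s0 mA mB AB; have iX := integrable_state bp vs mp lap x s x0 s0.
apply: fine_le.
- by apply: integrable_fin_num => //; apply: integrableS iX.
- by apply: integrable_fin_num => //; apply: integrableS iX.
- apply: ge0_subset_integral => //.
    by apply/measurable_EFinP; apply: measurable_funS (measurable_state mp s s0).
  by move=> w _; rewrite lee_fin (state_ge0 mp).
Qed.

(** Markov's inequality with the mean restricted to the event, so that the bound inherits the
    smallness of E[X_s; X_s > K]. *)
Lemma large_state_le (x s K : R) : 0 <= x -> 0 <= s -> 0 < K ->
  fine (P x [set w | K < X s w]) <= K^-1 * \int[P x]_(w in [set w | K < X s w]) X s w.
Proof.
move=> x0 s0 K0; have iX := integrable_state bp vs mp lap x s x0 s0.
have mA : measurable [set w | K < X s w].
  rewrite (_ : mkset _ = ~` [set w | X s w <= K]).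
    by apply: measurableC; apply: (past_measurable mp s); exact: past_state_le.
  by apply/seteqP; split => w /=; rewrite ltNge => /negP.
rewrite ler_pdivlMl// -Rintegral_cst//.
apply: le_Rintegral => //.
- exact: finite_measure_integrable_cst.
- by apply: integrableS iX.
- by move=> w /= /ltW.
Qed.

(** States up to K give the sharp estimate. Between K and 1/h the crude bound applies, above 1/h
    Markov's inequality; together they cost at most (C + 1) h E[X_s; X_s > K]. *)
Lemma step_upper (x t r de u eta : R) : 0 <= x -> 0 < t -> 0 < r -> 0 < de ->
  levy_tail r < u -> 0 < eta ->
  exists2 h0, 0 < h0 & forall h s, 0 < h < h0 -> 0 <= s <= t ->
   (1 - expR (- r)) ^+ 2 * fine (P x [set w | r + de < X (s + h) w - X s w]) <=
     h * (u * (x * expR (- (alpha * s))) + eta).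
Proof.
move=> x0 t0 r0 de0 ru eta0.
have rde0 : 0 < r + de by lra.
have u0 : 0 <= u by apply: le_trans (ltW ru); rewrite fine_ge0.
(* C precedes K and does not depend on it, so K can be taken large enough to beat it. *)
have [C C0 hC] := large_increment_bound bp vs mp lap _ rde0.
have e0 : 0 < eta / (C + 1) by rewrite divr_gt0//; lra.
have [K K0 hK] := state_window_mean_ge bp vs mp lap x t _ x0 (ltW t0) e0.
have [h1 h10 H1] := large_increment_le bp vs mp lap _ _ _ _ r0 de0 (ltW K0) ru.
exists (Num.min h1 (Num.min 1 K^-1)); first by rewrite !lt_min h10 ltr01 invr_gt0.
move=> h s /andP[h0]; rewrite !lt_min => /andP[hh1 /andP[hlt1 hK1]] s0t.
have /andP[s0 st] := s0t.
have KV : K <= h^-1 by rewrite -[K]invrK lef_pV2 ?posrE ?invr_gt0// ltW.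
set I := [set w | _]; pose A1 := [set w | X s w <= K].
pose A2 := [set w | X s w <= h^-1] `&` ~` A1.
pose A3 := [set w | h^-1 < X s w].
have p1 : past X s A1 by exact: past_state_le.
have p2 : past X s A2 by apply: pastI; [exact: past_state_le|exact: pastC].
have mA1 := past_measurable mp _ _ p1.
have mA2 := past_measurable mp _ _ p2.
have mC : measurable (~` A1) by exact: measurableC.
have mA3 : measurable A3.
  rewrite /A3 (_ : mkset _ = ~` [set w | X s w <= h^-1]).
    by apply: measurableC; apply: (past_measurable mp s); exact: past_state_le.
  by apply/seteqP; split => w /=; rewrite ltNge => /negP.
have mI : measurable I by apply: (measurable_increment mp) => //; exact: ltW.
have cov : I `<=` (A1 `&` I) `|` ((A2 `&` I) `|` A3).
  move=> w Iw; rewrite /= /A2 /A3 /A1/=.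
  case: (leP (X s w) K) => [wK|Kw]; first by left.
  case: (leP (X s w) h^-1) => [wh|hw]; last by right; right.
  by right; left; split => //; split => //; apply/negP; rewrite -ltNge.
have mA1I : measurable (A1 `&` I) by exact: measurableI.
have mA2I : measurable (A2 `&` I) by exact: measurableI.
have mU2 : measurable ((A2 `&` I) `|` A3) by exact: measurableU.
have PI := le_fine_probability (P x) _ _ mI (measurableU _ _ mA1I mU2) cov.
have PU := fine_probabilityU_le (P x) _ _ mA1I mU2.
have PU2 := fine_probabilityU_le (P x) _ _ mA2I mA3.
have hh : 0 < h < h1 by rewrite h0.
have hh' : 0 < h <= 1 by rewrite h0 ltW.
have B1 := H1 x s h A1 x0 s0 hh p1 (fun w H => H).
have B2 := hC x s h A2 x0 s0 hh' p2 (fun w H => proj1 H).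
have hV0 : 0 < h^-1 by rewrite invr_gt0.
have B3 := large_state_le x s h^-1 x0 s0 hV0; rewrite -/A3 invrK in B3.
have sub2 : A2 `<=` ~` A1 by move=> w [].
have sub3 : A3 `<=` ~` A1.
  by move=> w /= hw; apply/negP; rewrite -ltNge (le_lt_trans KV).
have I2 := subset_Rintegral_state x s _ _ x0 s0 mA2 mC sub2.
have I3 := subset_Rintegral_state x s _ _ x0 s0 mA3 mC sub3.
have split := Rintegral_state_split bp vs mp lap x s _ x0 s0 mA1.
have win := hK s s0t; rewrite -/A1 in win.
set k := (1 - expR (- r)) ^+ 2 in B1 *.
have k01 : 0 <= k <= 1.
  rewrite /k sqr_ge0 expr_le1//; have := expRN_le1 _ (ltW r0).
    by have := expR_ge0 (- r); lra.
  by lra.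
have X1 := Rintegral_state_ge0 mp x s A1 s0.
have XC := Rintegral_state_ge0 mp x s (~` A1) s0.
exact: (step_upper_arith h0 C0 u0 eta0 k01 X1 XC PI PU PU2 B1 B2 B3 I2 I3 split win).
Qed.

Lemma hits_upper (x t r de u eta : R) : 0 <= x -> 0 < t -> 0 < r -> 0 < de ->
  levy_tail r < u -> 0 < eta ->
  exists2 h0, 0 < h0 & forall h N, 0 < h < h0 -> N%:R * h <= t ->
   (1 - expR (- r)) ^+ 2 * fine (P x (hits h (r + de) N)) <=
     u * x * (h * \sum_(i < N) expR (- (alpha * (i%:R * h)))) + eta * t.
Proof.
move=> x0 t0 r0 de0 ru eta0.
have [h0 h00 H] := step_upper x t r de u eta x0 t0 r0 de0 ru eta0.
exists h0 => // h N hh Nt; have /andP[hp _] := hh.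
set k := (1 - expR (- r)) ^+ 2 in H *.
have k0 : 0 <= k by exact: sqr_ge0.
suff IH n : (n <= N)%N -> k * fine (P x (hits h (r + de) n)) <=
     u * x * (h * \sum_(i < n) expR (- (alpha * (i%:R * h)))) + eta * (n%:R * h).
  apply: le_trans (IH N (leqnn _)) _; rewrite lerD2l.
  by apply: ler_wpM2l => //; exact: ltW.
elim: n => [_|n IH nN].
  by rewrite hits0 measure0 big_ord0 !mul0r !mulr0 addr0.
have hp' := ltW hp.
have mH := measurable_hits h (r + de) n hp'.
have mI := measurable_grid_increment h (r + de) n hp'.
rewrite hitsS big_ord_recr/=.
have PU := fine_probabilityU_le (P x) _ _ mH mI.
have nt : 0 <= n%:R * h <= t.
  rewrite mulr_ge0//= (le_trans _ Nt)//; apply: ler_wpM2r => //.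
  by rewrite ler_nat ltnW.
have := H h (n%:R * h) hh nt; have := IH (ltnW nN); have := ler_wpM2l k0 PU.
rewrite -natr1; move: (fine _) (fine _) (fine _) (\sum_(i < n) _).
move: (expR (- (alpha * (n%:R * h)))) => E a b c S.
clear; rewrite !mulrDr !mulrDl mul1r; lra.
Qed.

(** Step n is counted only on paths with no earlier hit, which makes the contributions of distinct
    steps disjoint. *)
Lemma hits_lower (x t r de K e l : R) : 0 <= x -> 0 < t -> 0 < r -> 0 < de ->
  0 < K -> 0 < e ->
  (forall s, 0 <= s <= t ->
    x * expR (- (alpha * s)) - e <= \int[P x]_(w in [set w | X s w <= K]) X s w) ->
  0 <= l -> l < (1 - expR (- r)) ^+ 2 * levy_tail (r + de) ->
  exists2 h0, 0 < h0 & forall h N, 0 < h < h0 -> N%:R * h <= t ->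
    l * (x * (h * \sum_(i < N) expR (- (alpha * (i%:R * h)))) - e * t) <=
    fine (P x (hits h r N)) * (1 + l * K * t).
Proof.
move=> x0 t0 r0 de0 K0 e0 hK l0 lr.
have [h0 h00 H] := large_increment_ge bp vs mp lap r de K l r0 de0 (ltW K0) l0 lr.
exists h0 => // h N hh Nt; have /andP[hp _] := hh.
have hp' := ltW hp.
set pN := fine (P x (hits h r N)).
have pN0 : 0 <= pN by rewrite /pN fine_ge0.
(* The mean lost to earlier hits is bounded by K times the final probability [pN] instead of the
   current one, so the induction stays additive; moving [pN] to the other side produces the factor 1
   + l K t. *)
suff IH n : (n <= N)%N -> l * (x * (h * \sum_(i < n) expR (- (alpha * (i%:R * h)))) -
      (e + K * pN) * (n%:R * h)) <= fine (P x (hits h r n)).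
  have := IH N (leqnn _); rewrite -/pN.
  have : l * ((e + K * pN) * (N%:R * h)) <= l * ((e + K * pN) * t).
    apply: ler_wpM2l => //; apply: ler_wpM2l => //.
    by rewrite addr_ge0 ?mulr_ge0// ltW.
  move: (\sum_(i < N) _) (N%:R * h) => S a; clear.
  rewrite !(mulrDr, mulrBr, mulrDl, mulrBl).
  rewrite (_ : pN * (l * K * t) = l * (K * pN * t)); last by ring.
  by rewrite mulr1; lra.
elim: n => [_|n IH nN].
  by rewrite hits0 measure0 big_ord0 !mul0r !mulr0 subr0 mulr0.
have mH := measurable_hits h r n hp'.
have mI := measurable_grid_increment h r n hp'.
have s0 : 0 <= n%:R * h by rewrite mulr_ge0.
have nt : 0 <= n%:R * h <= t.
  rewrite s0/= (le_trans _ Nt)//; apply: ler_wpM2r => //.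
  by rewrite ler_nat ltnW.
set s := n%:R * h in mI s0 nt *.
pose I := [set w | r < X (s + h) w - X s w].
pose W := [set w | X s w <= K]; pose Hn := hits h r n.
have pW : past X s W by exact: past_state_le.
have pH : past X s Hn by exact: past_hits.
have pA : past X s (W `&` ~` Hn) by apply: pastI => //; exact: pastC.
have mW := past_measurable mp _ _ pW.
have mA := past_measurable mp _ _ pA.
have mHC : measurable (~` Hn) by exact: measurableC.
have B1 := H x s h (W `&` ~` Hn) x0 s0 hh pA (fun w Hw => proj1 Hw).
have mAI : measurable ((W `&` ~` Hn) `&` I) by exact: measurableI.
have P1 : fine (P x Hn) + fine (P x ((W `&` ~` Hn) `&` I)) <=
    fine (P x (hits h r n.+1)).
  rewrite -fine_probabilityU//.
    apply: le_fine_probability; [exact: measurableU|exact: measurable_hits|].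
    by rewrite hitsS => w [|[]]; [left|right].
  by apply/seteqP; split => w //= [Hw [[_]]].
have mWH : measurable (W `&` Hn) by exact: measurableI.
have iX := integrable_state bp vs mp lap x s x0 s0.
have IW : \int[P x]_(w in W) X s w =
    \int[P x]_(w in W `&` ~` Hn) X s w + \int[P x]_(w in W `&` Hn) X s w.
  rewrite -Rintegral_setU//.
  - by rewrite -setIUr setUC setUv setIT.
  - by apply: integrableS iX => //; exact: measurableU.
  - apply/disj_set2P; apply/seteqP; split => w //= [[_ Hw] [_]]; exact: Hw.
have IH2 : \int[P x]_(w in W `&` Hn) X s w <= K * pN.
  apply: (@le_trans _ _ (\int[P x]_(w in W `&` Hn) K)).
    apply: le_Rintegral => //.
    - by apply: integrableS iX.
    - exact: finite_measure_integrable_cst.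
    - by move=> w [].
  rewrite Rintegral_cst//; apply: ler_wpM2l; first exact: ltW.
  apply: le_fine_probability => //; first exact: measurable_hits.
  by move=> w [_]; apply: subset_hits; exact: ltnW.
have win := hK s nt; rewrite -/W IW in win.
have key : h * l * (x * expR (- (alpha * s)) - e - K * pN) <=
    fine (P x ((W `&` ~` Hn) `&` I)).
  apply: le_trans B1; apply: ler_wpM2l; first by rewrite mulr_ge0.
  by move: win IH2; clear; lra.
have := IH (ltnW nN); rewrite big_ord_recr/= -natr1 -/s -/Hn.
move: P1 key; move: (fine _) (fine _) (fine _) (\sum_(i < n) _) (expR _) => a b c S E.
rewrite (_ : (n%:R + 1) * h = s + h); last by rewrite mulrDl mul1r.
clear; lra.
Qed.

End GridHits.

Lemma ler_div_succ {R : realType} (c m q : R) : 0 <= c -> 0 < m -> 0 <= q ->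
  c / (m * (q + 1)) * q <= c / m.
Proof.
move=> c0 m0 q0; rewrite invfM mulrA -mulrA ler_piMr//.
  by rewrite divr_ge0// ltW.
by rewrite mulrC ler_pdivrMr; lra.
Qed.

(** * From grids to the largest jump *)

Section JumpProbability.
Context {R : realType} {alpha beta : R}
  { pi : {sigma_finite_measure set R -> \bar R} }.
Hypothesis bp : branching_parameters alpha beta pi.
Notation Phi := (branching_mechanism alpha beta pi).
Notation levy_tail r := (fine (pi `]r, +oo[%classic)).
Context {v : R -> R -> R}.
Hypothesis vs : forall l, 0 <= l -> cumulant_solution Phi l (fun t => v t l).
Context {d : measure_display} {T : measurableType d}.
Context {X : R -> T -> R} {P : R -> probability T R}.
Hypothesis mp : markov_process X P.
Hypothesis lap : forall x t l : R, 0 <= x -> 0 <= t -> 0 <= l ->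
  ('E_(P x)[(fun w => expR (- (l * X t w)))] = (expR (- (x * v t l)))%:E)%E.
Hypothesis rc : forall w, rcll (fun t => X t w).
Variables (x t : R).
Hypotheses (x0 : 0 <= x) (t0 : 0 < t).

Let step n : R := t / n.+1%:R.
Let step_ge0 n : 0 <= step n. Proof. by rewrite divr_ge0// ltW. Qed.
Let step_gt0 n : 0 < step n. Proof. by rewrite divr_gt0. Qed.
Let step_total n : n.+1%:R * step n <= t.
Proof. by rewrite /step mulrC divfK// pnatr_eq0. Qed.

(** k sets the margin above r and n the mesh t/(n+1). *)
Let hit (k n : nat) (r : R) : set T := hits (X := X) (step n) (r + k.+1%:R^-1) n.+1.
Let rsum n : R := step n * \sum_(i < n.+1) expR (- (alpha * (i%:R * step n))).
Let k_gt0 (k : nat) : 0 < k.+1%:R^-1 :> R. Proof. by rewrite invr_gt0. Qed.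

Let mhit k n r : measurable (hit k n r).
Proof. exact: (measurable_hits mp). Qed.

Definition jump_event (r : R) : set T :=
  [set w | (r%:E < sup_jump (fun s => X s w) t)%E].

(** One index serves both as margin and as starting rank, which makes [stay r] nondecreasing and a
    single union sufficient. *)
Let stay (r : R) (k : nat) : set T := \bigcap_(n in [set n | (k <= n)%N]) hit k n r.

Let mstay r k : measurable (stay r k).
Proof. by apply: bigcap_measurableType => n _; exact: mhit. Qed.

Let le_hit r j k n : (j <= k)%N -> hit j n r `<=` hit k n r.
Proof.
move=> jk w [i iN H]; exists i => //; apply: le_lt_trans H.
by rewrite lerD2l lef_pV2 ?posrE// ler_nat.
Qed.

(** Reduces a supremum over uncountably many times to countably many events, which also yields
    measurability. *)
Lemma jump_eventE r : 0 < r -> jump_event r = \bigcup_k stay r k.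
Proof.
move=> r0; apply/seteqP; split => w.
  move=> /(sup_jump_grid _ _ _ (rc w))[k [N _ HN]].
  exists (maxn k N) => // n /= kn; apply: (le_hit r k); first exact: leq_maxl.
  by apply: HN => /=; apply: leq_trans kn; exact: leq_maxr.
move=> [k _ Hk]; apply: (grid_sup_jump _ _ _ k (rc w) t0 r0) => N.
exists (maxn k N); first exact: leq_maxr.
by apply: (Hk (maxn k N)); exact: leq_maxl.
Qed.

Lemma measurable_jump_event r : 0 < r -> measurable (jump_event r).
Proof. by move=> r0; rewrite jump_eventE//; apply: bigcup_measurable => k _. Qed.

Let nondecreasing_stay r : nondecreasing_seq (stay r).
Proof.
move=> j k jk; apply/subsetPset => w H n /= kn; apply: (le_hit r j) => //.
by apply: H => /=; exact: leq_trans kn.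
Qed.

Lemma jump_event_le (r : R) : 0 < r ->
  (1 - expR (- r)) ^+ 2 * fine (P x (jump_event r)) <=
    x * discount alpha t * levy_tail r.
Proof.
move=> r0; set k2 := (1 - expR (- r)) ^+ 2; have k20 : 0 <= k2 by exact: sqr_ge0.
have D0 := discount_gt0 alpha t t0.
have xD : 0 <= x * discount alpha t by rewrite mulr_ge0// ltW.
have tl0 : 0 <= levy_tail r by rewrite fine_ge0.
(* [stay r k] lies in every hit event of rank n >= k, so one sufficiently fine grid suffices. The
   thirds of e cover the excess of u over the tail, the error eta t, and the Riemann sum. *)
have bound k : k2 * fine (P x (stay r k)) <= x * discount alpha t * levy_tail r.
  apply/ler_addgt0Pr => e e0.
  pose e1 := e / (3 * (x * discount alpha t + 1)).
  have e10 : 0 < e1 by rewrite divr_gt0//; lra.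
  have e1E : e1 * (x * discount alpha t) <= e / 3.
    by apply: ler_div_succ => //; exact: ltW.
  have ru : levy_tail r < levy_tail r + e1 by lra.
  set u := levy_tail r + e1 in ru.
  have u0 : 0 <= u by rewrite addr_ge0// ltW.
  have eta0 : 0 < e / (3 * t) by rewrite divr_gt0// mulr_gt0.
  have [h0 h00 H] := hits_upper bp vs mp lap x t r _ u _ x0 t0 r0 (k_gt0 k) ru eta0.
  have d0 : 0 < e / (3 * (u * x + 1)).
    by rewrite divr_gt0// mulr_gt0// ltr_wpDl// mulr_ge0.
  have [n [kn hn dn]] : exists n, [/\ (k <= n)%N, step n < h0 &
      `|rsum n - discount alpha t| <= e / (3 * (u * x + 1))].
    near \oo => n; exists n; split.
    - by near: n; exact: nbhs_infty_ge.
    - by near: n; exact: near_infty_step.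
    - by near: n; exact: discount_cvg.
  have hh : 0 < step n < h0 by rewrite step_gt0.
  have := H (step n) n.+1 hh (step_total n); rewrite -/k2 -/(rsum n) => Hn.
  have le1 : k2 * fine (P x (stay r k)) <= k2 * fine (P x (hit k n r)).
    apply: ler_wpM2l => //; apply: le_fine_probability => //.
    by move=> w /(_ n kn).
  apply: le_trans le1 _; apply: le_trans Hn _.
  have -> : e / (3 * t) * t = e / 3 by field; rewrite gt_eqF.
  have ux0 : 0 <= u * x by rewrite mulr_ge0.
  have : u * x * (rsum n - discount alpha t) <= e / 3.
    apply: (@le_trans _ _ (u * x * (e / (3 * (u * x + 1))))).
      by apply: ler_wpM2l => //; apply: le_trans dn; exact: ler_norm.
    by rewrite mulrC; apply: ler_div_succ => //; exact: ltW.
  have -> : u * x * (rsum n - discount alpha t) =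
      u * x * rsum n - x * discount alpha t * levy_tail r - e1 * (x * discount alpha t).
    by rewrite /u; ring.
  lra.
have mE := measurable_jump_event r r0.
have cv : P x (stay r k) @[k --> \oo] --> P x (jump_event r).
  rewrite jump_eventE//; apply: nondecreasing_cvg_mu => //.
  by rewrite -jump_eventE.
have /fine_cvg cv' : P x (stay r k) @[k --> \oo] --> (fine (P x (jump_event r)))%:E.
  by rewrite fineK ?fin_num_measure.
have cv2 : k2 * fine (P x (stay r k)) @[k --> \oo] --> k2 * fine (P x (jump_event r)).
  by apply: cvgM; [exact: cvg_cst|exact: cv'].
rewrite -(cvg_lim _ cv2)//; apply: limr_le; first by apply/cvg_ex; eexists; exact: cv2.
by apply: nearW => k; exact: bound.
Unshelve. all: by end_near. Qed.

(** Hits on arbitrarily fine grids force a jump, so the jump event contains the decreasing limit of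
    the unions of late hits, each at least as probable as a single late hit. *)
Lemma jump_event_ge (r K e : R) (l := (1 - expR (- r)) ^+ 2 * levy_tail r) :
  0 < r -> 0 < K -> 0 < e ->
  (forall s, 0 <= s <= t ->
    x * expR (- (alpha * s)) - e <= \int[P x]_(w in [set w | X s w <= K]) X s w) ->
  l * (x * discount alpha t - e * t) <= fine (P x (jump_event r)) * (1 + l * K * t).
Proof.
move=> r0 K0 e0 hK.
have k20 : 0 <= (1 - expR (- r)) ^+ 2 by exact: sqr_ge0.
have l0 : 0 <= l by rewrite /l mulr_ge0 ?fine_ge0.
have mE := measurable_jump_event r r0.
set p := fine (P x (jump_event r)).
have /andP[p0 p1] : 0 <= p <= 1 by exact: fine_probability_le1.
set y := x * discount alpha t - e * t.
(* A strict inequality a < l survives small margins in both r and the tail; afterwards a is let tend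
   to l. *)
have main a : 0 <= a -> a < l -> a * y <= p * (1 + a * K * t).
  move=> a0 al; have q0 : 0 < 1 + a * K * t.
    by apply: ltr_pwDl => //; rewrite !mulr_ge0// ltW.
  have [j hj] : exists j : nat, a < (1 - expR (- r)) ^+ 2 * levy_tail (r + j.+1%:R^-1).
    have cv : (1 - expR (- r)) ^+ 2 * levy_tail (r + n.+1%:R^-1) @[n --> \oo] --> l.
      by apply: cvgM; [exact: cvg_cst|exact: (levy_tail_shift bp)].
    have [N _ HN] := cvgr_gt _ cv _ al.
    by exists N; exact: (HN N (leqnn _)).
  (* m + 1 = 2(j + 1), so two margins 1/(m+1) make up 1/(j+1): one separates grid increments from
     jumps, the other is the gap of the polynomial. *)
  pose m := j.*2.+1.
  pose dm : R := m.+1%:R^-1.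
  have dm0 : 0 < dm by exact: k_gt0.
  have mm : r + dm + dm = r + j.+1%:R^-1.
    rewrite -addrA; congr (_ + _); rewrite /dm /m -doubleS -mul2n natrM.
    have j0 : j.+1%:R != 0 :> R by rewrite pnatr_eq0.
    by move: (j.+1%:R) j0 => c c0; field.
  have rm0 : 0 < r + dm by rewrite addr_gt0.
  have hm : a < (1 - expR (- (r + dm))) ^+ 2 * levy_tail (r + dm + dm).
    apply: lt_le_trans hj _; rewrite mm; apply: ler_wpM2r; first by rewrite fine_ge0.
    have e1 := expRN_le1 _ (ltW r0).
    have e2 : expR (- (r + dm)) <= expR (- r) by rewrite ler_expR lerN2 lerDl ltW.
    apply: lerXn2r; rewrite ?nnegrE ?subr_ge0//; first exact: le_trans e2 e1.
    by rewrite lerD2l lerN2.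
  have [h0 h00 H] := hits_lower bp vs mp lap x t (r + dm) dm K e a
    x0 t0 rm0 dm0 K0 e0 hK a0 hm.
  pose U i : set T := \bigcup_(n in [set n | (i <= n)%N]) hit m n r.
  have mU i : measurable (U i) by apply: bigcup_measurable => n _; exact: mhit.
  have bU i : a * y <= fine (P x (U i)) * (1 + a * K * t).
    apply/ler_addgt0Pr => f f0.
    have d0 : 0 < f / (a * x + 1) by rewrite divr_gt0// ltr_wpDl// mulr_ge0.
    have [n [kn hn dn]] : exists n, [/\ (i <= n)%N, step n < h0 &
        `|rsum n - discount alpha t| <= f / (a * x + 1)].
      near \oo => n; exists n; split.
      - by near: n; exact: nbhs_infty_ge.
      - by near: n; exact: near_infty_step.
      - by near: n; exact: discount_cvg.
    have hh : 0 < step n < h0 by rewrite step_gt0.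
    have := H (step n) n.+1 hh (step_total n); rewrite -/(rsum n) => Hn.
    have le1 : fine (P x (hit m n r)) * (1 + a * K * t) <=
        fine (P x (U i)) * (1 + a * K * t).
      apply: ler_wpM2r; first exact: ltW.
      by apply: le_fine_probability => // w Hw; exists n.
    have ax0 : 0 <= a * x by rewrite mulr_ge0.
    have : a * x * (discount alpha t - rsum n) <= f.
      apply: (@le_trans _ _ (a * x * (f / (a * x + 1)))).
        by apply: ler_wpM2l => //; apply: le_trans dn; rewrite distrC ler_norm.
      rewrite mulrC -mulrA ler_piMr//; first exact: ltW.
      by rewrite mulrC ler_pdivrMr; lra.
    move=> h1; have h2 := le_trans Hn le1.
    rewrite (_ : a * y =
        a * (x * rsum n - e * t) + a * x * (discount alpha t - rsum n)).
      by apply: lerD.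
    by rewrite /y; ring.
  have UE : \bigcap_i U i `<=` jump_event r.
    move=> w Hw; apply: (grid_sup_jump _ _ _ m (rc w) t0 r0) => N.
    by have [n /= Nn Hn] := Hw N I; exists n.
  have mcap : measurable (\bigcap_i U i) by apply: bigcap_measurableType.
  have cv : P x (U i) @[i --> \oo] --> P x (\bigcap_i U i).
    apply: nonincreasing_cvg_mu => //.
    - by apply: le_lt_trans (probability_le1 _ (mU 0%N)) _; rewrite ltry.
    - move=> i j' ij; apply/subsetPset => w [n /= jn Hn]; exists n => //=.
      exact: leq_trans ij jn.
  have /fine_cvg cv' : P x (U i) @[i --> \oo] --> (fine (P x (\bigcap_i U i)))%:E.
    by rewrite fineK ?fin_num_measure.
  have cv2 : fine (P x (U i)) * (1 + a * K * t) @[i --> \oo] -->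
      fine (P x (\bigcap_i U i)) * (1 + a * K * t).
    by apply: cvgM; [exact: cv'|exact: cvg_cst].
  apply: (@le_trans _ _ (fine (P x (\bigcap_i U i)) * (1 + a * K * t))).
    rewrite -(cvg_lim _ cv2)//; apply: limr_ge.
      by apply/cvg_ex; eexists; exact: cv2.
    by apply: nearW => i; exact: bU.
  apply: ler_wpM2r; first exact: ltW.
  exact: le_fine_probability.
apply/ler_addgt0Pr => f f0.
(* Replacing l by l - dl costs at most f; the absolute value is there because y may be negative. *)
pose dl := Num.min l (f / (`|y| + 1)).
have y1 : 0 < `|y| + 1 by rewrite ltr_wpDl.
have f1 : 0 < f / (`|y| + 1) by rewrite divr_gt0.
move: l0; rewrite le_eqVlt => /predU1P[l00|l00].
  by rewrite -l00 !mul0r addr0 mulr1 addr_ge0// ltW.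
have dl0 : 0 < dl by rewrite lt_min l00.
have al0 : 0 <= l - dl by rewrite subr_ge0 ge_min lexx.
have al : l - dl < l by rewrite ltrBlDr ltrDl.
have := main _ al0 al.
have : dl * y <= f.
  apply: le_trans (ler_wpM2l (ltW dl0) (ler_norm y)) _.
  apply: (@le_trans _ _ (f / (`|y| + 1) * `|y|)).
    by apply: ler_wpM2r => //; rewrite ge_min lexx orbT.
  rewrite -mulrA ler_piMr//; first exact: ltW.
  by rewrite mulrC ler_pdivrMr// mul1r lerDl.
have : p * (1 + (l - dl) * K * t) <= p * (1 + l * K * t).
  apply: ler_wpM2l => //; rewrite lerD2l; apply: ler_wpM2r; first exact: ltW.
  by apply: ler_wpM2r; [exact: ltW|rewrite gerBl ltW].
move=> h1 h2 h3; rewrite (_ : l * y = (l - dl) * y + dl * y); last by ring.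
by apply: lerD => //; exact: le_trans h3 h1.
Unshelve. all: by end_near. Qed.

End JumpProbability.

(** rho is the ratio of the theorem, k = (1 - e^-r)^2, a the relative mean lost by truncating at K,
    and z the loss due to repeated hits. *)
Lemma ratio_squeeze {R : realType} {rho k z a e : R} : 0 < e < 1 -> 0 <= a <= e / 4 ->
  0 <= z <= e / 4 -> 1 - e / 4 <= k <= 1 -> 0 <= rho ->
  rho * k <= 1 -> k * (1 - a) <= rho * (1 + z) -> `|1 - rho| <= e.
Proof.
move=> /andP[e0 e1] /andP[a0 ae] /andP[z0 ze] /andP[k0 k1] rho0 up low.
rewrite ler_norml; apply/andP; split.
  rewrite leNgt; apply/negP => h; have : 1 + e < rho by lra.
  move=> h1; have : (1 + e) * (1 - e / 4) <= rho * k by apply: ler_pM; lra.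
  nra.
rewrite leNgt; apply/negP => h; have h1 : rho <= 1 - e by lra.
have h2 : rho * (1 + z) <= (1 - e) * (1 + e / 4) by apply: ler_pM; lra.
have h3 : (1 - e / 4) * (1 - e / 4) <= k * (1 - a) by apply: ler_pM; lra.
nra.
Qed.

Theorem theorem3p3 (R : realType) (alpha beta : R)
  (pi : {sigma_finite_measure set R -> \bar R})
  (d : measure_display) (T : measurableType d)
  (X : R -> T -> R) (P : R -> probability T R) (x t : R) :
  branching_parameters alpha beta pi ->
  cb_process (branching_mechanism alpha beta pi) X P ->
  0 < x ->
  unbounded_measure pi ->
  0 < t ->
  fine (P x [set w | (r%:E < sup_jump (fun s => X s w) t)%E])
    / (x * discount alpha t * fine (pi `]r, +oo[%classic)) @[r --> +oo] --> (1 : R).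
Proof.
move=> bp [mp rc [v vs lap]] x0 unb t0.
have D0 := discount_gt0 alpha t t0.
have xD0 : 0 < x * discount alpha t by exact: mulr_gt0.
apply/cvgrPdist_le => e' e'0.
pose e := Num.min e' (1 / 2).
have e0 : 0 < e by rewrite lt_min e'0; lra.
have e1 : e < 1 by rewrite gt_min; apply/orP; right; lra.
have ee' : e <= e' by rewrite ge_min lexx.
(* Scaled so that eps t is the fraction e/4 of x [discount alpha t]. *)
pose eps := e / 4 * (x * discount alpha t) / t.
have eps0 : 0 < eps by rewrite divr_gt0// mulr_gt0//; lra.
have epst : eps * t = e / 4 * (x * discount alpha t).
  by rewrite /eps divfK// gt_eqF.
(* K is fixed before r, so the repeated-hit loss k K t pi(r, oo) vanishes as r grows. *)
have [K K0 hK] := state_window_mean_ge bp vs mp lap x t _ (ltW x0) (ltW t0) eps0.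
have q0 : 0 < e / 4 / (K * t) by rewrite divr_gt0 ?mulr_gt0//; lra.
have h8 : 0 < e / 8 by lra.
near=> r.
have r1 : 1 <= r by near: r; exact: nbhs_pinfty_ge.
have r0 : 0 < r by lra.
have tl0 := levy_tail_gt0 bp _ unb r0.
have tls : fine (pi `]r, +oo[%classic) <= e / 4 / (K * t).
  near: r; have /cvgrPdist_le/(_ _ q0) := levy_tail_cvg0 bp.
  apply: filterS => r; rewrite sub0r normrN; apply: le_trans; exact: ler_norm.
have er : expR (- r) <= e / 8.
  rewrite -[e / 8]lnK ?posrE// ler_expR lerNl; near: r.
  by apply: nbhs_pinfty_ge; rewrite num_real.
have er0 := expR_ge0 (- r).
have up := jump_event_le bp vs mp lap rc x t (ltW x0) t0 r r0.
have low := jump_event_ge bp vs mp lap rc x t (ltW x0) t0 r K eps r0 K0 eps0 hK.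
rewrite epst in low.
set k := (1 - expR (- r)) ^+ 2 in up low.
have k1 : 1 - e / 4 <= k <= 1.
  apply/andP; split; first by rewrite /k; nra.
  by rewrite /k expr_le1//; lra.
have /andP[k0' k1'] := k1.
have k0 : 0 <= k by exact: sqr_ge0.
set p := fine (P x _); rewrite -/p in up low.
have p0 : 0 <= p by rewrite /p fine_ge0.
set tl := fine (pi _) in tl0 tls up low *.
apply: le_trans ee'.
clearbody k p tl e.
have KT : 0 < K * t by exact: mulr_gt0.
have den : 0 < x * discount alpha t * tl by exact: mulr_gt0.
have e01 : 0 < e < 1 by rewrite e0.
have a01 : 0 <= e / 4 <= e / 4 by rewrite lexx andbT; lra.
have z01 : 0 <= k * tl * K * t <= e / 4.
  rewrite !mulr_ge0 ?(ltW tl0) ?(ltW K0) ?(ltW t0)//=.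
  rewrite -mulrA; apply: (@le_trans _ _ (tl * (K * t))); last by rewrite -ler_pdivlMr.
  by apply: ler_wpM2r; [exact: ltW|rewrite ler_piMl// ltW].
have rho0 : 0 <= p / (x * discount alpha t * tl) by rewrite divr_ge0// ltW.
apply: (ratio_squeeze e01 a01 z01 k1 rho0).
  by rewrite mulrAC ler_pdivrMr// mul1r mulrC.
rewrite mulrAC ler_pdivlMr//; apply: le_trans low.
by rewrite le_eqVlt; apply/orP; left; apply/eqP; ring.
Unshelve. all: by end_near. Qed.
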